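(* Let $f:\mathbb{R}^n\to\mathbb{R}$ be of class $\mathcal{C}^{2+}$, and let $\phi(x)=h(\|x\|)$ with $h=\frac12|\cdot|^2+\delta_{[-1,1]}$. Let $L,\bar L>0$ and suppose that the set $$U:=\{x\in\mathbb{R}^n\mid\|\nabla f(x)\|\ne\bar L\}$$ has full measure, i.e. $\mathbb{R}^n\setminus U$ has Lebesgue measure zero. Suppose that $f$ satisfies the second-order condition for $(L,\bar L)$-anisotropic smoothness relative to $\phi$: $\lambda_{\max}(\nabla^2\phi^*(\bar L^{-1}\nabla f(x))\nabla^2 f(x))\le L\bar L$ for all $x\in U$. Let $0<\gamma<\frac1L$ and consider the iterates of the preconditioned gradient method $$x^{k+1}=x^k-\gamma\nabla\phi^*(\bar L^{-1}\nabla f(x^k))=x^k-\gamma\min\Big(\frac{1}{\|\nabla f(x^k)\|},\bar L^{-1}\Big)\nabla f(x^k),\qquad k\in\mathbb{N},$$ where the initial iterate $x^0\in\mathbb{R}^n$ is chosen at random. Let $\mathcal{X}^\star=\{x^\star\mid\nabla f(x^\star)=0,\ \lambda_{\min}(\nabla^2 f(x^\star))<0\}$. Then $$\mathbb{P}\Big(\lim_{k\to\infty}x^k\in\mathcal{X}^\star\Big)=0,$$ that is, the set of initial points $x^0\in\mathbb{R}^n$ for which $(x^k)_{k\in\mathbb{N}}$ converges to a point of $\mathcal{X}^\star$ has Lebesgue measure zero.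
   Context: $f\in\mathcal{C}^{2+}$ means that $f$ is twice continuously differentiable with locally Lipschitz continuous Hessian. $\delta_{[-1,1]}$ is the indicator function ($0$ on $[-1,1]$, $+\infty$ elsewhere). $\phi^*$ is the convex conjugate of $\phi$; here $\nabla\phi^*(y)=\min\{1,1/\|y\|\}\,y$ (equal to $0$ at $y=0$), which is continuously differentiable away from the unit sphere $\|y\|=1$, so $\nabla^2\phi^*(\bar L^{-1}\nabla f(x))$ is well defined for $x\in U$. When $\nabla f(x^k)=0$ the update is $x^{k+1}=x^k$. *)

(* Defs.v *)
From mathcomp Require Import all_boot all_order all_algebra.
From mathcomp Require Import all_classical all_reals all_analysis.
Set Implicit Arguments.
Unset Strict Implicit.
Unset Printing Implicit Defensive.
Import Order.TTheory GRing.Theory Num.Theory.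
Import numFieldNormedType.Exports.

Local Open Scope classical_set_scope.
Local Open Scope ring_scope.

(* Vectors of R^n are row vectors. The library norm `|x| on 'rV[R]_n is the
   sup norm, so the Euclidean norm is introduced separately; both induce the
   same topology and the same locally Lipschitz maps. *)

Definition dot (R : realType) (n : nat) (x y : 'rV[R]_n) : R :=
  \sum_(i < n) x 0 i * y 0 i.

Definition enorm (R : realType) (n : nat) (x : 'rV[R]_n) : R :=
  Num.sqrt (dot x x).

Definition gradient (R : realType) (n : nat) (f : 'rV[R]_n -> R)
    (x : 'rV[R]_n) : 'rV[R]_n :=
  \row_(i < n) 'D_(delta_mx 0 i) f x.

(* Entry (i, j) is the i-th partial derivative of the j-th partial derivative
   of f, since the library Jacobian acts on row vectors from the right. *)
Definition hessian (R : realType) (n : nat) (f : 'rV[R]_n -> R)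
    (x : 'rV[R]_n) : 'M[R]_n :=
  jacobian (gradient f) x.

Definition C2plus (R : realType) (n : nat) (f : 'rV[R]_n -> R) : Prop :=
  [/\ forall x, differentiable f x,
      forall x, differentiable (gradient f) x,
      continuous (hessian f : 'rV[R]_n -> 'M[R]_(n, n)) &
      forall x : 'rV[R]_n, exists2 V : set 'rV[R]_n, nbhs x V &
        [lipschitz (hessian f y : 'M[R]_(n, n)) | y in V]].

(* Largest and smallest real eigenvalue. They are only applied to matrices with
   a real spectrum: a symmetric matrix, or the product of a symmetric positive
   semidefinite matrix and a symmetric one. For n = 0 both are 0. *)
Definition lambda_max (R : realType) (n : nat) (A : 'M[R]_n) : R :=
  sup [set a | eigenvalue A a].

Definition lambda_min (R : realType) (n : nat) (A : 'M[R]_n) : R :=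
  inf [set a | eigenvalue A a].

Definition set_indicator (R : realType) (T : Type) (A : set T) (x : T) : \bar R :=
  if `[< A x >] then 0%E else +oo%E.

Definition h (R : realType) (t : R) : \bar R :=
  ((`|t| ^+ 2 / 2)%:E + set_indicator R `[(-1)%R, 1%R] t)%E.

Definition phi (R : realType) (n : nat) (x : 'rV[R]_n) : \bar R := h (enorm x).

Definition conjugate (R : realType) (n : nat) (p : 'rV[R]_n -> \bar R)
    (y : 'rV[R]_n) : \bar R :=
  ereal_sup [set ((dot x y)%:E - p x)%E | x in [set: 'rV[R]_n]].

(* The conjugate of phi only takes finite values, so that nothing is lost in
   regarding it as a real-valued function in order to differentiate it. *)
Definition phi_star (R : realType) (n : nat) (y : 'rV[R]_n) : R :=
  fine (conjugate (@phi R n) y).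

Definition pgm_step (R : realType) (n : nat) (f : 'rV[R]_n -> R)
    (gamma Lbar : R) (x : 'rV[R]_n) : 'rV[R]_n :=
  x - gamma *: gradient (@phi_star R n) (Lbar^-1 *: gradient f x).

Definition pgm (R : realType) (n : nat) (f : 'rV[R]_n -> R)
    (gamma Lbar : R) (x0 : 'rV[R]_n) (k : nat) : 'rV[R]_n :=
  iter k (pgm_step f gamma Lbar) x0.

Definition strict_saddle (R : realType) (n : nat) (f : 'rV[R]_n -> R) :
    set 'rV[R]_n :=
  [set x | gradient f x = 0 /\ lambda_min (hessian f x) < 0].

Definition box (R : realType) (n : nat) (a b : 'rV[R]_n) : set 'rV[R]_n :=
  [set x | forall i : 'I_n, a 0 i <= x 0 i <= b 0 i].

Definition box_volume (R : realType) (n : nat) (a b : 'rV[R]_n) : R :=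
  \prod_(i < n) Num.max 0 (b 0 i - a 0 i).

(* Lebesgue outer measure on R^n. The index set D allows for finite and empty
   covers, which matters when n = 0: there the only box is the whole space,
   with volume 1. *)
Definition lebesgue_outer (R : realType) (n : nat) (A : set 'rV[R]_n) : \bar R :=
  ereal_inf [set v : \bar R |
    exists (D : set nat) (a b : nat -> 'rV[R]_n),
      A `<=` \bigcup_(k in D) box (a k) (b k) /\
      v = (\esum_(k in D) (box_volume (a k) (b k))%:E)%E].

(* Sets of outer measure zero are automatically Lebesgue measurable. *)
Definition lebesgue_null (R : realType) (n : nat) (A : set 'rV[R]_n) : Prop :=
  lebesgue_outer A = 0%E.

(* Main.v *)
Require Import Defs.
From mathcomp Require Import all_boot all_order all_algebra.
From mathcomp Require Import all_classical all_reals all_analysis.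
From mathcomp Require Import ring lra.
Import Order.TTheory GRing.Theory Num.Theory.
Import numFieldNormedType.Exports.

(** Write T for the map iterated by the method. Two facts give the theorem: preimages
under T of null sets are null, and around each strict saddle x there is a ball B
such that the set of points whose whole orbit stays in B is null. An orbit
converging to x enters such a B for good, so the starting points in question lie
in a union of sets T^-m (points trapped in B), and the second countability of R^n
reduces the union over all saddles to a countable one.

Preimages. The gradient of phi^* is the projection onto the unit ball
([gradient_phi_star]), so T is strictly differentiable at each point of U, with
derivative 1 - (gamma / Lbar) H P (row vector convention), H being the Hessian of f
and P that of phi^*. If it were singular, Lbar / gamma would be an eigenvalue of
P H, which the second-order condition and gamma L < 1 exclude
([step_derivative_unit]). A map with an invertible strict derivative expands
distances near the point by some factor c > 0, and such a map pulls null sets back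
to null sets: a small cube of side s has a preimage of diameter at most s / c
([lebesgue_null_expanding]).

Saddles. A cone argument shows that trapped points lie on a Lipschitz graph. At a
strict saddle the derivative A of T is symmetric (the Hessian is, by Schwarz's
theorem [hessian_sym]) and has an eigenvalue alpha > 1. Choose nu strictly between
1 and alpha^2 outside the spectrum of A^2, put N = A^2 - nu and p(w) = <w, w N>.
As A and N commute, p(w A) = nu p(w) + |w N|^2, and the last term, which is at least
a multiple of |w|^2, absorbs the nonlinearity of T near the saddle. Hence p of the
difference of two trapped orbits grows at least like nu^k when it starts positive,
although it has to stay bounded: differences of trapped points satisfy p <= 0. Since
p is positive at an eigenvector v for alpha, the projection along v to a hyperplane
is bounded below on such differences, so the trapped set is the preimage
of a null set under an expanding map ([lebesgue_null_cone]). *)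

Set Implicit Arguments.
Unset Strict Implicit.
Unset Printing Implicit Defensive.

Local Open Scope classical_set_scope.
Local Open Scope ring_scope.

(** * Lebesgue outer measure and null sets *)

Section OuterMeasure.
Context {R : realType} {n : nat}.
Implicit Types (A B : set 'rV[R]_n) (a b : 'rV[R]_n).

Lemma box_volume_ge0 a b : 0 <= box_volume a b.
Proof. by apply: prodr_ge0 => i _; rewrite le_max lexx. Qed.

Lemma lebesgue_outer_ge0 A : (0 <= lebesgue_outer A)%E.
Proof.
apply: le_ereal_inf_tmp => _ [D [a [b [_ ->]]]].
by apply: esum_ge0 => k _; rewrite lee_fin box_volume_ge0.
Qed.

Lemma le_lebesgue_outer A B : A `<=` B ->
  (lebesgue_outer A <= lebesgue_outer B)%E.
Proof.
move=> AB; apply: ereal_inf_le_tmp => _ [D [a [b [BD ->]]]].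
by exists D, a, b; split => //; exact: subset_trans BD.
Qed.

Lemma lebesgue_outer_box a b : (lebesgue_outer (box a b) <= (box_volume a b)%:E)%E.
Proof.
apply: ereal_inf_lbound; exists [set 0%N], (fun=> a), (fun=> b); split.
  by move=> x bx; exists 0%N.
by rewrite esum_set1// lee_fin box_volume_ge0.
Qed.

Lemma lebesgue_outer0 : lebesgue_outer (set0 : set 'rV[R]_n) = 0%E.
Proof.
apply/eqP; rewrite eq_le lebesgue_outer_ge0 andbT.
apply: ereal_inf_lbound; exists set0, (fun=> 0), (fun=> 0); split => //.
by rewrite esum_set0.
Qed.

(** The usual argument: cover the k-th set up to an error e / 2^(k+1) and renumber the
doubly indexed family of boxes along a bijection between nat and nat * nat. *)
Lemma lebesgue_outer_bigcup (A : nat -> set 'rV[R]_n) :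
  (lebesgue_outer (\bigcup_k A k) <= \sum_(k <oo) lebesgue_outer (A k))%E.
Proof.
have [[i ioo]|] := pselect (exists i, lebesgue_outer (A i) = +oo%E).
  rewrite (eseries_pinfty _ _ ioo) ?leey// => k _.
  by rewrite -ltNye (lt_le_trans _ (lebesgue_outer_ge0 _)).
rewrite -forallNE => Aoo.
apply/lee_addgt0Pr => e e0.
rewrite (le_trans _ (epsilon_trick _ _ (ltW e0)))//; last first.
  by move=> k; exact: lebesgue_outer_ge0.
pose P k (G : set nat * (nat -> 'rV[R]_n) * (nat -> 'rV[R]_n)) :=
  A k `<=` \bigcup_(i in G.1.1) box (G.1.2 i) (G.2 i) /\
  (\esum_(i in G.1.1) (box_volume (G.1.2 i) (G.2 i))%:E <=
   lebesgue_outer (A k) + (e / (2 ^ k.+1)%:R)%:E)%E.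
have [G PG] : {G & forall k, P k (G k)}.
  apply: (@choice _ _ P) => k.
  have ek : 0 < e / (2 ^ k.+1)%:R by rewrite divr_gt0// ltr0n expn_gt0.
  have fin : lebesgue_outer (A k) \is a fin_num.
    by rewrite ge0_fin_numE ?lebesgue_outer_ge0// ltey; apply/eqP/Aoo.
  have [x [D [a [b [AD ->]]]] xS] := lb_ereal_inf_adherent ek fin.
  by exists (D, a, b); split => //; exact: ltW.
pose vol (p : nat * nat) := (box_volume ((G p.1).1.2 p.2) ((G p.1).2 p.2))%:E.
have vol0 p : (0 <= vol p)%E by rewrite lee_fin box_volume_ge0.
have /card_esym/ppcard_eqP[g] := card_nat2.
pose K := [set: nat] `*`` (fun k => (G k).1.1).
apply: (@le_trans _ _ (\esum_(p in K) vol p)).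
  apply: ereal_inf_lbound.
  exists (g @^-1` K), (fun m => (G (g m).1).1.2 (g m).2),
    (fun m => (G (g m).1).2 (g m).2); split.
    move=> x [k _ /(PG k).1 [i Di xi]].
    by exists (g^-1%FUN (k, i)); rewrite /= invK ?inE.
  rewrite -[RHS](@esum_image _ _ _ _ g vol); last first.
    by move=> i j _ _; exact: injT.
  by congr esum; rewrite image_preimage// image_eq.
rewrite -(@esum_esum _ _ _ setT (fun k => (G k).1.1) (fun k i => vol (k, i)))//.
rewrite nneseries_esumT; last first.
  move=> k; rewrite adde_ge0 ?lebesgue_outer_ge0// lee_fin divr_ge0//.
  exact: ltW.
by apply: le_esum => k _; exact: (PG k).2.
Qed.

Lemma lebesgue_null_sub A B : A `<=` B -> lebesgue_null B -> lebesgue_null A.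
Proof.
move=> AB B0; apply/eqP; rewrite eq_le lebesgue_outer_ge0 andbT -B0.
exact: le_lebesgue_outer.
Qed.

Lemma lebesgue_null_bigcup (A : nat -> set 'rV[R]_n) :
  (forall k, lebesgue_null (A k)) -> lebesgue_null (\bigcup_k A k).
Proof.
move=> A0; apply/eqP; rewrite eq_le lebesgue_outer_ge0 andbT.
by rewrite (le_trans (lebesgue_outer_bigcup _))// eseries0 // => k _ _; exact: A0.
Qed.

Lemma lebesgue_null_bigcup_countType (I : countType) (A : I -> set 'rV[R]_n) :
  (forall i, lebesgue_null (A i)) -> lebesgue_null (\bigcup_i A i).
Proof.
move=> A0; pose A' m := if unpickle m is Some i then A i else set0.
apply: (@lebesgue_null_sub _ (\bigcup_m A' m)).
  by move=> x [i _ Aix]; exists (pickle i) => //; rewrite /A' pickleK.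
apply: lebesgue_null_bigcup => m; rewrite /A'.
by case: unpickle => //; exact: lebesgue_outer0.
Qed.

Lemma lebesgue_nullU A B :
  lebesgue_null A -> lebesgue_null B -> lebesgue_null (A `|` B).
Proof.
move=> A0 B0; apply: (@lebesgue_null_sub _ (\bigcup_(b : bool) if b then A else B)).
  by move=> x [Ax|Bx]; [exists true|exists false].
by apply: lebesgue_null_bigcup_countType => -[].
Qed.

Lemma lebesgue_outer_bigcup_fin (I : finType) (A : I -> set 'rV[R]_n) (v : I -> R) :
  (forall i, lebesgue_outer (A i) <= (v i)%:E)%E ->
  (lebesgue_outer (\bigcup_i A i) <= (\sum_i v i)%:E)%E.
Proof.
move=> Av.
pose A' m := if insub m is Some j then A (@enum_val I predT j) else set0.
have -> : \bigcup_i A i = \bigcup_m A' m.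
  apply/seteqP; split => [x [i _ Aix]|x [m _]]; rewrite /A'.
    by exists (enum_rank i) => //; rewrite valK enum_rankK.
  by case: insubP => // j _ _ xA; exists (enum_val j).
rewrite (le_trans (lebesgue_outer_bigcup _))//.
rewrite (nneseries_split 0 #|I|); last by move=> k _; exact: lebesgue_outer_ge0.
rewrite [X in (_ + X)%E]eseries0 ?adde0; last first.
  move=> k; rewrite add0n => Ik _ ; rewrite /A' insubF ?lebesgue_outer0//.
  by rewrite ltnNge Ik.
rewrite add0n big_mkord -sumEFin (reindex (@enum_val I predT))/=; last first.
  exact/onW_bij/enum_val_bij.
by apply: lee_sum => i _; rewrite /A' valK.
Qed.

End OuterMeasure.

(** * Preimages of null sets under expanding maps *)

Section SupNorm.
Context {R : realType} {m n : nat}.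
Implicit Types (x y : 'M[R]_(m, n)).

Lemma ler_norm_entry x i j : `|x i j| <= `|x|.
Proof.
rewrite [leRHS]mx_normrE.
by apply: (@le_bigmax _ _ _ 0 (fun k : 'I_m * 'I_n => `|x k.1 k.2|) (i, j)).
Qed.

Lemma ler_mx_norm x (r : R) : 0 <= r -> (forall i j, `|x i j| <= r) -> `|x| <= r.
Proof.
move=> r0 xr; rewrite [leLHS]mx_normrE; apply/bigmax_leP; split => // -[i j] _.
Qed.

End SupNorm.

Section ExpandingPreimage.
Context {R : realType} {n : nat}.
Implicit Types (V Z : set 'rV[R]_n) (a b : 'rV[R]_n) (G : 'rV[R]_n -> 'rV[R]_n).

Lemma lebesgue_outer_diam V (r : R) : 0 <= r ->
  (forall y z, V y -> V z -> `|y - z| <= r) ->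
  (lebesgue_outer V <= (\prod_(i < n) (2 * r))%:E)%E.
Proof.
move=> r0 Vr; have [->|/set0P[y Vy]] := eqVneq V set0.
  by rewrite lebesgue_outer0 lee_fin prodr_ge0// => i _; rewrite mulr_ge0.
apply: (@le_trans _ _ (lebesgue_outer (box (y - const_mx r) (y + const_mx r)))).
  apply: le_lebesgue_outer => z Vz i; rewrite !mxE -ler_distlC.
  by have := ler_norm_entry (y - z) 0 i; rewrite !mxE => /le_trans; apply; exact: Vr.
rewrite (le_trans (lebesgue_outer_box _ _))// lee_fin /box_volume.
apply: ler_prod => i _; rewrite le_max lexx/= !mxE ge_max mulr_ge0//=; lra.
Qed.

(** The box is cut into cubes of side s. The preimage of a cube has diameter at most
s / c, so it fits in a cube of side 2 s / c, and the i-th side of the box needs at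
most (its length) / s + 1 pieces. *)
Lemma lebesgue_outer_expanding_grid G V a b (c s : R) : 0 < c -> 0 < s ->
  (forall y z, V y -> V z -> c * `|y - z| <= `|G y - G z|) ->
  (lebesgue_outer (V `&` G @^-1` box a b) <=
   (\prod_(i < n) ((Num.max 0 (b 0 i - a 0 i) + s) * (2 / c)))%:E)%E.
Proof.
move=> c0 s0 VG.
pose l i := Num.max 0 (b 0 i - a 0 i).
have l0 i : 0 <= l i by rewrite le_max lexx.
pose N i := (Num.truncn (l i / s)).+1.
pose M := (\sum_(i < n) N i)%N.
have NM i : (N i <= M)%N by rewrite /M (bigD1 i)//= leq_addr.
(* M bounds every N i, so that one finite function type indexes all cells; the
   functions with some g i >= N i give empty cells and weight 0. *)
pose cell (g : {ffun 'I_n -> 'I_M}) := [set x : 'rV[R]_n | forall i,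
  (g i < N i)%N /\ a 0 i + (g i)%:R * s <= x 0 i <= a 0 i + (g i).+1%:R * s].
pose v (g : {ffun 'I_n -> 'I_M}) :=
  \prod_(i < n) (if (g i < N i)%N then 2 * (s / c) else 0).
have v0 g : 0 <= v g.
  by apply: prodr_ge0 => i _; case: ifP => // _; rewrite mulr_ge0// divr_ge0// ltW.
have outer_cell g : (lebesgue_outer (V `&` G @^-1` cell g) <= (v g)%:E)%E.
  have [gN|] := boolP [forall i, (g i < N i)%N]; last first.
    rewrite negb_forall => /existsP[i gi].
    rewrite (_ : _ `&` _ = set0) ?lebesgue_outer0 ?lee_fin//.
    by apply/seteqP; split => // x [_ /(_ i)[]]; rewrite (negbTE gi).
  have -> : v g = \prod_(i < n) (2 * (s / c)).
    by apply: eq_bigr => i _; rewrite (forallP gN).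
  apply: lebesgue_outer_diam => [|y z [Vy gy] [Vz gz]].
    by rewrite divr_ge0// ltW.
  rewrite ler_pdivlMr// mulrC (le_trans (VG _ _ Vy Vz))//.
  apply: ler_mx_norm => [|i j]; first exact: ltW.
  rewrite ord1 !mxE; have [_ +] := gy j; have [_ +] := gz j.
  rewrite -natr1 mulrDl mul1r => /andP[z1 z2] /andP[y1 y2].
  rewrite ler_norml; apply/andP; split; lra.
apply: (@le_trans _ _ (lebesgue_outer (\bigcup_g (V `&` G @^-1` cell g)))).
  apply: le_lebesgue_outer => x [Vx Gx].
  pose k i := Num.truncn ((G x 0 i - a 0 i) / s).
  have k0 i : 0 <= (G x 0 i - a 0 i) / s.
    by rewrite divr_ge0 ?(ltW s0)// subr_ge0; case/andP: (Gx i).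
  have kN i : (k i < N i)%N.
    rewrite ltnS /k; apply: le_truncn; rewrite ler_pM2r ?invr_gt0//.
    by rewrite le_max lerB ?orbT//; case/andP: (Gx i).
  have kM i : (k i < M)%N by exact: leq_trans (NM i).
  exists [ffun i => Ordinal (kM i)] => //; split => // i.
  rewrite !ffunE/=; split => //.
  have /andP[k1 k2] := truncn_itv (k0 i).
  move: k1 k2; rewrite ler_pdivlMr// ltr_pdivrMr// => k1 k2.
  by apply/andP; split; lra.
rewrite (le_trans (lebesgue_outer_bigcup_fin outer_cell))// lee_fin /v.
rewrite -(bigA_distr_bigA (fun i (k : 'I_M) => if (k < N i)%N then 2 * (s / c) else 0)).
apply: ler_prod => i _; rewrite sumr_ge0/=; last first.
  by move=> k _; case: ifP => // _; rewrite mulr_ge0// divr_ge0// ltW.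
rewrite -big_mkcond/= -(big_ord_widen _ (fun=> 2 * (s / c)))//.
rewrite sumr_const card_ord -[(2 * (s / c)) *+ _]mulr_natr.
have -> : 2 * (s / c) * (N i)%:R = ((N i)%:R * s) * (2 / c) by field; lra.
rewrite ler_pM2r ?divr_gt0// -natr1 mulrDl mul1r lerD2r -ler_pdivlMr//.
by rewrite truncn_le divr_ge0// ltW.
Qed.

(** Letting s tend to 0 in the grid estimate removes the loss due to rounding, also for
degenerate boxes. *)
Lemma lebesgue_outer_expanding_box G V a b (c : R) : 0 < c ->
  (forall y z, V y -> V z -> c * `|y - z| <= `|G y - G z|) ->
  (lebesgue_outer (V `&` G @^-1` box a b) <=
   ((2 / c) ^+ n * box_volume a b)%:E)%E.
Proof.
move=> c0 VG.
(* At s = 0 the grid bound is the claimed one. *)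
pose w (s : R) := \prod_(i < n) ((Num.max 0 (b 0 i - a 0 i) + s) * (2 / c)).
have wc : w s @[s --> 0] --> w 0.
  apply: cvg_big => [|i _]; first exact: mul_continuous.
  by apply: cvgM; [apply: cvgD; [exact: cvg_cst|exact: cvg_id]|exact: cvg_cst].
have w0 : w 0 = (2 / c) ^+ n * box_volume a b.
  rewrite /w big_split/= prodr_const card_ord mulrC; congr (_ * _).
  by apply: eq_bigr => i _; rewrite addr0.
rewrite -w0.
have : (w s)%:E @[s --> 0^'+] --> (w 0)%:E.
  apply: cvg_EFin; first exact: nearW.
  by apply: cvg_at_right_filter.
move=> wE; rewrite -(cvg_lim _ wE)//.
apply: lime_ge; first by apply/cvg_ex; exists (w 0)%:E.
near=> s; apply: lebesgue_outer_expanding_grid => //.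
Unshelve. all: by end_near. Qed.

(** Each box of a cover of Z is replaced by its preimage in V, whose outer measure is at most
(2 / c)^n times the volume of the box. *)
Lemma lebesgue_null_expanding G V Z (c : R) : 0 < c ->
  (forall y z, V y -> V z -> c * `|y - z| <= `|G y - G z|) ->
  lebesgue_null Z -> lebesgue_null (V `&` G @^-1` Z).
Proof.
move=> c0 VG Z0; apply/eqP; rewrite eq_le lebesgue_outer_ge0 andbT.
apply/lee_addgt0Pr => e e0; rewrite add0e.
have k0 : 0 < (2 / c) ^+ n by rewrite exprn_gt0// divr_gt0.
have fin : lebesgue_outer Z \is a fin_num by rewrite Z0.
have [_ [D [a [b [ZD ->]]]]] := lb_ereal_inf_adherent (divr_gt0 e0 k0) fin.
rewrite -/(lebesgue_outer Z) Z0 add0e => De.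
pose A k := if k \in D then V `&` G @^-1` box (a k) (b k) else set0.
apply: (@le_trans _ _ (lebesgue_outer (\bigcup_k A k))).
  apply: le_lebesgue_outer => x [Vx /ZD[k Dk xk]]; exists k => //.
  by rewrite /A mem_set.
rewrite (le_trans (lebesgue_outer_bigcup _))//.
rewrite nneseries_esumT => [|k]; last exact: lebesgue_outer_ge0.
pose w k := if k \in D then (box_volume (a k) (b k))%:E else 0%E.
have w0 k : (0 <= w k)%E by rewrite /w; case: ifP; rewrite // lee_fin box_volume_ge0.
apply: (@le_trans _ _ (\sum_(k <oo) (((2 / c) ^+ n)%:E * w k))%E).
  rewrite nneseries_esumT => [|k]; last by rewrite mule_ge0// lee_fin ltW.
  apply: le_esum => k _; rewrite /A /w.
  case: ifP => _; last by rewrite lebesgue_outer0 mule0.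
  by rewrite -EFinM; exact: lebesgue_outer_expanding_box.
rewrite nneseriesZl// nneseries_esumT// /w -esum_mkcond.
by rewrite muleC -lee_pdivlMr// ltW// -EFinM.
Qed.

End ExpandingPreimage.

(** * Strict derivatives *)

Section MulmxBound.
Context {R : realType}.

Lemma mulmx_bound m n (A : 'M[R]_(m, n)) :
  exists2 C, 0 < C & forall v : 'rV_m, `|v *m A| <= C * `|v|.
Proof.
exists (1 + \sum_i \sum_j `|A i j|).
  by rewrite ltr_pwDl// sumr_ge0// => i _; rewrite sumr_ge0.
move=> v; apply: ler_mx_norm => [|k j].
  by rewrite mulr_ge0// addr_ge0// sumr_ge0// => i _; rewrite sumr_ge0.
rewrite ord1 !mxE (le_trans (ler_norm_sum _ _ _))// mulrDl mul1r ler_wpDl//.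
rewrite mulr_suml ler_sum// => i _; rewrite normrM mulrC ler_pM// ?ler_norm_entry//.
by rewrite (bigD1 j)//= lerDl sumr_ge0.
Qed.

Lemma mulmx_norm_le m n (A : 'M[R]_(m, n)) (v : 'rV_m) (r : R) : 0 <= r ->
  (forall i j, `|A i j| <= r) -> `|v *m A| <= m%:R * r * `|v|.
Proof.
move=> r0 Ar; apply: ler_mx_norm => [|k j]; first by rewrite !mulr_ge0.
rewrite ord1 !mxE (le_trans (ler_norm_sum _ _ _))//.
apply: (@le_trans _ _ (\sum_(i < m) (r * `|v|))).
  by apply: ler_sum => i _; rewrite normrM mulrC ler_pM// ler_norm_entry.
by rewrite sumr_const card_ord -mulrA mulr_natl.
Qed.

End MulmxBound.

Section EpsilonDelta.
Context {R : realType} {V W : normedModType R}.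

Lemma continuous_at_epsdelta (f : V -> W) (x : V) : {for x, continuous f} <->
  forall e : R, 0 < e ->
    exists2 r : R, 0 < r & forall y, `|y - x| < r -> `|f y - f x| <= e.
Proof.
split=> [/cvgrPdist_le cf e /cf /nbhs_ballP[r r0 fr]|cf].
  exists r => // y yr; rewrite distrC; apply: fr.
  by rewrite -ball_normE /ball_/= distrC.
apply/cvgrPdist_le => e /cf[r r0 fr]; apply/nbhs_ballP; exists r => // y.
by rewrite -ball_normE /ball_/= distrC => /fr; rewrite distrC.
Qed.

Lemma near_epsdelta (P : set V) (x : V) : (\forall y \near x, P y) <->
  exists2 r : R, 0 < r & forall y, `|y - x| < r -> P y.
Proof.
split=> [/nbhs_ballP[r r0 Pr]|[r r0 Pr]].
  by exists r => // y yr; apply: Pr; rewrite -ball_normE /ball_/= distrC.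
apply/nbhs_ballP; exists r => // y; rewrite -ball_normE /ball_/= distrC.
exact: Pr.
Qed.

End EpsilonDelta.

Section LineDerivative.
Context {R : realType} {V : normedModType R}.

(** The difference quotients on both sides are the same function of the increment. *)
Lemma is_derive_line (W : normedModType R) (g : V -> W) (z w : V) (t : R) :
  derivable g (z + t *: w) w ->
  is_derive t 1 (fun s : R => g (z + s *: w)) ('D_w g (z + t *: w)).
Proof.
move=> dg.
have E : (fun h : R => h^-1 *: (((fun s : R => g (z + s *: w)) \o shift t) (h *: 1)
            - g (z + t *: w)))
       = (fun h : R => h^-1 *: ((g \o shift (z + t *: w)) (h *: w) - g (z + t *: w))).
  apply/funext => h /=; congr (_ *: (g _ - _)).
  by rewrite [h *: 1]mulr1 scalerDl addrCA.
by split; rewrite /derivable /derive E.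
Qed.

Lemma MVT_line (g : V -> R) (z w : V) :
  (forall t : R, derivable g (z + t *: w) w) ->
  exists2 t : R, 0 <= t <= 1 & g (z + w) - g z = 'D_w g (z + t *: w).
Proof.
move=> dg.
have d (t : R) : is_derive t 1 (fun s : R => g (z + s *: w)) ('D_w g (z + t *: w)).
  exact: is_derive_line.
have [t tab] := @MVT_segment R (fun s : R => g (z + s *: w))
  (fun t => 'D_w g (z + t *: w)) 0 1 ler01 (fun t _ => d t)
  (@derivable_within_continuous _ _ _ `[0, 1] (fun t _ => @ex_derive _ _ _ _ _ _ _ (d t))).
by rewrite scale1r scale0r addr0 subr0 mulr1 => ?; exists t; rewrite // -in_itv.
Qed.

End LineDerivative.

Section StrictDerivative.
Context {R : realType}.

(** Both endpoints move, unlike in the Frechet derivative. This is the notion from which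
local injectivity follows directly; A acts on row vectors from the right, as the
Jacobian does. *)
Definition strict_derivative m n (G : 'rV[R]_m -> 'rV[R]_n) (x : 'rV[R]_m)
    (A : 'M[R]_(m, n)) :=
  forall e : R, 0 < e -> exists2 r : R, 0 < r & forall y z,
    `|y - x| < r -> `|z - x| < r ->
    `|G y - G z - (y - z) *m A| <= e * `|y - z|.

Lemma strict_derivative_lipschitz m n (G : 'rV[R]_m -> 'rV[R]_n) x A :
  strict_derivative G x A ->
  exists r C : R, [/\ 0 < r, 0 < C & forall y z,
    `|y - x| < r -> `|z - x| < r -> `|G y - G z| <= C * `|y - z|].
Proof.
move=> /(_ 1 ltr01)[r r0 Gr]; have [C C0 AC] := mulmx_bound A.
exists r, (1 + C); split => //; first by rewrite addr_gt0.
move=> y z yr zr; rewrite -(subrK ((y - z) *m A) (G y - G z)).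
by rewrite (le_trans (ler_normD _ _))// mulrDl lerD// Gr.
Qed.

Lemma strict_derivative_id m (x : 'rV[R]_m) : strict_derivative id x 1%:M.
Proof.
move=> e e0; exists 1 => // y z _ _.
by rewrite mulmx1 subrr normr0 mulr_ge0// ltW.
Qed.

Lemma strict_derivativeZ m n (c : R) (G : 'rV[R]_m -> 'rV[R]_n) x A :
  strict_derivative G x A ->
  strict_derivative (fun y => c *: G y) x (c *: A).
Proof.
move=> GA e e0; have c0 : 0 < `|c| + 1 by rewrite ltr_wpDl.
have [r r0 Gr] := GA _ (divr_gt0 e0 c0).
exists r => // y z yr zr; rewrite -scalemxAr -!scalerBr normrZ.
rewrite (le_trans (ler_wpM2l (normr_ge0 _) (Gr _ _ yr zr)))//.
rewrite mulrA ler_wpM2r// mulrCA ler_piMr ?(ltW e0)//.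
by rewrite ler_pdivrMr// mul1r lerDl.
Qed.

Lemma strict_derivativeB m n (F G : 'rV[R]_m -> 'rV[R]_n) x A B :
  strict_derivative F x A -> strict_derivative G x B ->
  strict_derivative (fun y => F y - G y) x (A - B).
Proof.
move=> FA GB e e0; have e20 : 0 < e / 2 by rewrite divr_gt0.
have [r r0 Fr] := FA _ e20; have [s s0 Gs] := GB _ e20.
exists (Num.min r s) => [|y z]; first by rewrite lt_min r0.
rewrite !lt_min => /andP[yr ys] /andP[zr zs].
have -> : F y - G y - (F z - G z) - (y - z) *m (A - B) =
    (F y - F z - (y - z) *m A) - (G y - G z - (y - z) *m B).
  rewrite mulmxBr; move: (_ *m A) (_ *m B) => P Q.
  by apply/rowP => i; rewrite !mxE; ring.
rewrite (le_trans (ler_normB _ _))// [e]splitr mulrDl lerD//.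
- exact: Fr.
- exact: Gs.
Qed.

Lemma strict_derivative_comp m n p (F : 'rV[R]_m -> 'rV[R]_n)
    (G : 'rV[R]_n -> 'rV[R]_p) x A B :
  strict_derivative F x A -> strict_derivative G (F x) B ->
  strict_derivative (G \o F) x (A *m B).
Proof.
move=> FA GB e e0.
have [r1 [C [r10 C0 FC]]] := strict_derivative_lipschitz FA.
have [D D0 BD] := mulmx_bound B.
have [r2 r20 Gr] := GB (e / 2 / C) (divr_gt0 (divr_gt0 e0 (ltr0Sn R 1)) C0).
have [r3 r30 Fr] := FA (e / 2 / D) (divr_gt0 (divr_gt0 e0 (ltr0Sn R 1)) D0).
exists (Num.min (Num.min r1 r3) (r2 / C)) => [|y z].
  by rewrite !lt_min r10 r30 divr_gt0.
rewrite !lt_min => /andP[/andP[yr1 yr3] yr2] /andP[/andP[zr1 zr3] zr2].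
have x1 : `|x - x| < r1 by rewrite subrr normr0.
have Fx t : `|t - x| < r1 -> `|t - x| < r2 / C -> `|F t - F x| < r2.
  move=> t1 t2; rewrite (le_lt_trans (FC _ _ t1 x1))//.
  by rewrite mulrC -ltr_pdivlMr.
have -> : (G \o F) y - (G \o F) z - (y - z) *m (A *m B) =
    (G (F y) - G (F z) - (F y - F z) *m B) + (F y - F z - (y - z) *m A) *m B.
  by rewrite [X in _ = _ + X]mulmxBl mulmxA addrA subrK.
rewrite (le_trans (ler_normD _ _))// [e]splitr mulrDl lerD//.
- rewrite (le_trans (Gr _ _ (Fx _ yr1 yr2) (Fx _ zr1 zr2)))//.
  have k0 : 0 <= e / 2 / C by rewrite !divr_ge0// ltW.
  rewrite (le_trans (ler_wpM2l k0 (FC _ _ yr1 zr1)))//.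
  by rewrite mulrA divfK// gt_eqF.
- rewrite (le_trans (BD _))// mulrC -ler_pdivlMr// mulrAC.
  exact: Fr.
Qed.

Lemma strict_derivative_jacobian m n (G : 'rV[R]_m -> 'rV[R]_n) x A :
  strict_derivative G x A -> jacobian G x = A.
Proof.
move=> GA.
have Ac : continuous (fun v : 'rV[R]_m => v *m A).
  have [C C0 AC] := mulmx_bound A => v.
  apply/continuous_at_epsdelta => e e0.
  exists (e / C) => [|w vw]; first exact: divr_gt0.
  by rewrite -mulmxBl (le_trans (AC _))// mulrC -ler_pdivlMr// ltW.
have dG : 'd G x = mulmxr A :> (_ -> _).
  apply: diff_unique => //.
  apply/eqaddoP => e e0; have [r r0 Gr] := GA e e0.
  have : \forall h \near (0 : 'rV[R]_m),
      `|G (h + x) - G x - h *m A| <= e * `|h|.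
    apply/near_epsdelta; exists r => // h; rewrite subr0 => hr.
    by have := Gr (h + x) x; rewrite addrK subrr normr0 => /(_ hr r0).
  by apply: filterS => h; rewrite !fctE /= opprD addrA.
rewrite /jacobian; apply/row_matrixP => i.
by rewrite rowE mul_rV_lin1 dG /= -rowE.
Qed.

(** The mean value theorem on the segment from z to y, applied to each coordinate of G
separately since there is no mean value point common to all of them. *)
Lemma C1_strict_derivative m n (G : 'rV[R]_m -> 'rV[R]_n) x :
  (forall y, differentiable G y) ->
  {for x, continuous (jacobian G : 'rV[R]_m -> 'M[R]_(m, n))} ->
  strict_derivative G x (jacobian G x).
Proof.
move=> dG cG e e0.
have em0 : 0 < e / (m%:R + 1) by rewrite divr_gt0// ltr_wpDl.
have /continuous_at_epsdelta/(_ _ em0)[r r0 Gr] := cG.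
exists r => // y z yr zr.
apply: ler_mx_norm => [|k j]; first by rewrite mulr_ge0// ltW.
rewrite {k}ord1.
have dGj t : derivable (fun u => G u 0 j) (z + t *: (y - z)) (y - z).
  by move: (0 : 'I_1) j; apply/derivable_mxP/diff_derivable.
have [t /andP[t0 t1]] := MVT_line dGj.
rewrite subrKC => Gyz.
have -> : (G y - G z - (y - z) *m jacobian G x) 0 j =
  ((y - z) *m (jacobian G (z + t *: (y - z)) - jacobian G x)) 0 j.
  have {}Gyz : (G y - G z) 0 j = ((y - z) *m jacobian G (z + t *: (y - z))) 0 j.
    have := @deriveEjacobian _ _ _ G (z + t *: (y - z)) (y - z) (dG _) => <-.
    rewrite derive_mx; last exact: diff_derivable.
    by rewrite [RHS]mxE -Gyz !mxE.
  by rewrite mulmxBr mxE Gyz [RHS]mxE; congr (_ + _); rewrite !mxE.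
have xb : `|z + t *: (y - z) - x| < r.
  have -> : z + t *: (y - z) - x = (1 - t) *: (z - x) + t *: (y - x).
    by apply/rowP => i; rewrite !mxE; ring.
  rewrite (le_lt_trans (ler_normD _ _))// !normrZ ger0_norm ?subr_ge0//.
  rewrite (ger0_norm t0).
  have [->|t_neq1] := eqVneq t 1; first by rewrite subrr mul0r add0r mul1r.
  have {}t1 : 0 < 1 - t by rewrite subr_gt0 lt_neqAle t_neq1.
  have : (1 - t) * `|z - x| < (1 - t) * r by rewrite ltr_pM2l.
  have : t * `|y - x| <= t * r by rewrite ler_wpM2l// ltW.
  lra.
have {}Gr := Gr _ xb.
rewrite (le_trans (ler_norm_entry _ _ _))//.
rewrite (le_trans (@mulmx_norm_le _ _ _ _ _ (e / (m%:R + 1)) (ltW em0) _))//.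
  move=> i l; rewrite (le_trans (ler_norm_entry _ _ _))//; exact: Gr.
rewrite ler_wpM2r// mulrCA ler_piMr ?(ltW e0)//.
by rewrite ler_pdivrMr ?ltr_wpDl// mul1r lerDl.
Qed.

End StrictDerivative.

(** * Inner product and Euclidean norm *)

Section Dot.
Context {R : realType} {n : nat}.
Implicit Types (x y z : 'rV[R]_n).

Lemma dotE x y : dot x y = (x *m y^T) 0 0.
Proof. by rewrite mxE; apply: eq_bigr => i _; rewrite mxE. Qed.

Lemma dotC x y : dot x y = dot y x.
Proof. by apply: eq_bigr => i _; rewrite mulrC. Qed.

Lemma dotDl x y z : dot (x + y) z = dot x z + dot y z.
Proof. by rewrite !dotE mulmxDl mxE. Qed.

Lemma dotNl x z : dot (- x) z = - dot x z.
Proof. by rewrite !dotE mulNmx mxE. Qed.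

Lemma dotZl (a : R) x z : dot (a *: x) z = a * dot x z.
Proof. by rewrite !dotE -scalemxAl mxE. Qed.

Lemma dotDr x y z : dot z (x + y) = dot z x + dot z y.
Proof. by rewrite ![dot z _]dotC dotDl. Qed.

Lemma dotNr x z : dot z (- x) = - dot z x.
Proof. by rewrite ![dot z _]dotC dotNl. Qed.

Lemma dotZr (a : R) x z : dot z (a *: x) = a * dot z x.
Proof. by rewrite ![dot z _]dotC dotZl. Qed.

Definition dot_lin := (dotDl, dotDr, dotNl, dotNr, dotZl, dotZr).

Lemma dot_delta x i : dot (delta_mx 0 i) x = x 0 i.
Proof.
rewrite /dot (bigD1 i)//= mxE !eqxx mul1r big1 ?addr0// => j ji.
by rewrite mxE eqxx/= (negbTE ji) mul0r.
Qed.

Lemma dot_mulmx x y (A : 'M[R]_n) : dot (x *m A) y = dot x (y *m A^T).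
Proof. by rewrite !dotE trmx_mul trmxK mulmxA. Qed.

Lemma dotxx_ge0 x : 0 <= dot x x.
Proof. by apply: sumr_ge0 => i _; rewrite -expr2 sqr_ge0. Qed.

Lemma dot_bound x y : `|dot x y| <= n%:R * `|x| * `|y|.
Proof.
rewrite (le_trans (ler_norm_sum _ _ _))//.
apply: (@le_trans _ _ (\sum_(i < n) (`|x| * `|y|))).
  by apply: ler_sum => i _; rewrite normrM ler_pM// ler_norm_entry.
by rewrite sumr_const card_ord -mulrA mulr_natl.
Qed.

Lemma sqr_norm_le_dot x : `|x| ^+ 2 <= dot x x.
Proof.
suff : `|x| <= Num.sqrt (dot x x).
  by move=> /(lerXn2r 2 (normr_ge0 _) (sqrtr_ge0 _)); rewrite sqr_sqrtr ?dotxx_ge0.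
apply: ler_mx_norm => [|k i]; first exact: sqrtr_ge0.
rewrite ord1 -sqrtr_sqr ler_wsqrtr// /dot (bigD1 i)//= -expr2 lerDl.
by apply: sumr_ge0 => j _; rewrite -expr2 sqr_ge0.
Qed.

Lemma enorm_ge0 x : 0 <= enorm x.
Proof. exact: sqrtr_ge0. Qed.

Lemma enorm_sqr x : enorm x ^+ 2 = dot x x.
Proof. by rewrite sqr_sqrtr// dotxx_ge0. Qed.

Lemma norm_le_enorm x : `|x| <= enorm x.
Proof.
rewrite -(@ler_pXn2r _ 2)// ?nnegrE ?enorm_ge0//.
by rewrite enorm_sqr sqr_norm_le_dot.
Qed.

Lemma enormZ (a : R) x : 0 <= a -> enorm (a *: x) = a * enorm x.
Proof.
move=> a0; rewrite /enorm !dot_lin mulrA -expr2 sqrtrM ?sqr_ge0// sqrtr_sqr.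
by rewrite ger0_norm.
Qed.

(** Expand the square of (enorm y) x - (enorm x) y. *)
Lemma cauchy_schwarz x y : dot x y <= enorm x * enorm y.
Proof.
have [y0|y0] := eqVneq (enorm y) 0.
  have {}y0 : y = 0.
    by apply/eqP; rewrite -normr_eq0 eq_le normr_ge0 andbT -y0 norm_le_enorm.
  by rewrite y0 -(scale0r 0) !dot_lin mul0r mulr_ge0// enorm_ge0.
have {}y0 : 0 < enorm y by rewrite lt_neqAle eq_sym y0 enorm_ge0.
have [x0|x0] := eqVneq (enorm x) 0.
  have {}x0 : x = 0.
    by apply/eqP; rewrite -normr_eq0 eq_le normr_ge0 andbT -x0 norm_le_enorm.
  by rewrite x0 -(scale0r 0) !dot_lin mul0r mulr_ge0// enorm_ge0.
have {}x0 : 0 < enorm x by rewrite lt_neqAle eq_sym x0 enorm_ge0.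
have := dotxx_ge0 (enorm y *: x - enorm x *: y).
rewrite !dot_lin -!enorm_sqr (dotC y x) => H.
have : 0 <= 2 * (enorm x * enorm y) * (enorm x * enorm y - dot x y) by lra.
by rewrite pmulr_rge0 ?subr_ge0// !mulr_gt0.
Qed.

Lemma enorm_continuous : continuous (@enorm R n).
Proof.
have dc : continuous (fun y : 'rV[R]_n => dot y y).
  apply: continuous_big => [|i _]; first exact: add_continuous.
  by move=> x; apply: continuousM; exact: coord_continuous.
move=> x; apply: (@continuous_comp _ _ _ (fun y : 'rV[R]_n => dot y y) Num.sqrt).
  exact: dc.
exact: sqrt_continuous.
Qed.

End Dot.

(** * The conjugate of phi and the projection onto the unit ball *)

Section BallProjection.
Context {R : realType} {n : nat}.
Implicit Types (x y z : 'rV[R]_n).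

(** Dividing by the maximum of 1 and the norm gives one formula for the inside and the
outside of the ball, visibly continuous across the sphere and at 0. *)
Definition ball_proj y : 'rV[R]_n := (Num.max 1 (enorm y))^-1 *: y.

Lemma ball_proj_continuous : continuous ball_proj.
Proof.
move=> y.
have m0 : Num.max 1 (enorm y) != 0 by rewrite gt_eqF// lt_max ltr01.
apply: (@continuousZ R 'rV[R]_n 'rV[R]_n (fun y => (Num.max 1 (enorm y))^-1) id y);
  last by move=> z; exact: cvg_id.
apply: (@continuousV R 'rV[R]_n (fun y => Num.max 1 (enorm y)) y) => //.
apply: (@continuous_max _ _ (cst 1) (@enorm R n) y).
  exact: cst_continuous.
exact: enorm_continuous.
Qed.

Lemma ball_proj_small y : enorm y <= 1 -> ball_proj y = y.
Proof. by move=> y1; rewrite /ball_proj max_l// invr1 scale1r. Qed.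

Lemma ball_proj_large y : 1 <= enorm y -> ball_proj y = (enorm y)^-1 *: y.
Proof. by move=> y1; rewrite /ball_proj max_r. Qed.

Lemma enorm_ball_proj y : enorm (ball_proj y) <= 1.
Proof.
have [y1|/ltW y1] := leP (enorm y) 1; first by rewrite ball_proj_small.
rewrite ball_proj_large// enormZ ?invr_ge0 ?enorm_ge0// mulVf//.
by rewrite gt_eqF// (lt_le_trans ltr01).
Qed.

(** The supremum defining the conjugate of phi is attained at the projection of y. Inside
the ball this is a completed square; outside, by Cauchy-Schwarz, the objective is at
most r |y| - r^2 / 2 with r = |x|, which increases on [0, 1]. *)
Lemma ball_proj_max x y : enorm x <= 1 ->
  dot x y - dot x x / 2 <= dot (ball_proj y) y - dot (ball_proj y) (ball_proj y) / 2.
Proof.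
move=> x1; have [y1|/ltW y1] := leP (enorm y) 1.
  rewrite ball_proj_small//.
  by have := dotxx_ge0 (x - y); rewrite !dot_lin (dotC y x); lra.
have y0 : enorm y != 0 by rewrite gt_eqF// (lt_le_trans ltr01).
rewrite ball_proj_large// !dot_lin -!enorm_sqr.
have -> : (enorm y)^-1 * enorm y ^+ 2 - (enorm y)^-1 * ((enorm y)^-1 * enorm y ^+ 2) / 2
   = enorm y - 2^-1 by field.
have := cauchy_schwarz x y; have := enorm_ge0 x; nra.
Qed.

Lemma conjugate_phi y : conjugate (@phi R n) y =
  (dot (ball_proj y) y - dot (ball_proj y) (ball_proj y) / 2)%:E.
Proof.
have phi1 x : enorm x <= 1 -> phi x = (dot x x / 2)%:E.
  move=> x1; rewrite /phi /h /set_indicator asboolT ?adde0.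
    by rewrite ger0_norm ?enorm_ge0// enorm_sqr.
  by rewrite /= in_itv/= x1 andbT (le_trans _ (enorm_ge0 _))// lerN10.
apply/eqP; rewrite eq_le; apply/andP; split.
  apply: ge_ereal_sup => _ [x _ <-]; have [x1|x1] := leP (enorm x) 1.
    by rewrite phi1// -EFinB lee_fin ball_proj_max.
  rewrite /phi /h /set_indicator asboolF ?leNye//.
  by rewrite /= in_itv/= => /andP[_]; rewrite leNgt x1.
apply: ereal_sup_ubound; exists (ball_proj y) => //.
by rewrite phi1// enorm_ball_proj.
Qed.

Lemma phi_starE y : phi_star y =
  dot (ball_proj y) y - dot (ball_proj y) (ball_proj y) / 2.
Proof. by rewrite /phi_star conjugate_phi. Qed.

(** A conjugate function is a supremum of affine functions, and a maximizer at y gives an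
affine minorant that touches at y. *)
Lemma phi_star_subgradient y z :
  phi_star y + dot (ball_proj y) (z - y) <= phi_star z.
Proof.
rewrite !phi_starE; have := @ball_proj_max (ball_proj y) z (enorm_ball_proj y).
by rewrite !dot_lin; lra.
Qed.

(** The subgradient inequalities at y and at y + d enclose the remainder of the first
order expansion between 0 and <p(y + d) - p(y), d>, where p is the projection; as p is
continuous this is o(|d|), including when y lies on the unit sphere. *)
Lemma gradient_phi_star y : gradient (@phi_star R n) y = ball_proj y.
Proof.
apply/rowP => i; rewrite mxE; apply: cvg_lim => //.
apply/cvgrPdist_le => e e0.
have en0 : 0 < e / (n%:R + 1) by rewrite divr_gt0// ltr_wpDl.
have [r r0 pr] := (continuous_at_epsdelta _ _).1 (@ball_proj_continuous y) _ en0.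
near=> t.
have t0 : t != 0 by near: t; exact: nbhs_dnbhs_neq.
have tr : `|t| < r by near: t; exact: dnbhs0_lt.
set d : 'rV[R]_n := delta_mx 0 i.
have d1 : `|d| <= 1.
  apply: ler_mx_norm => // k j; rewrite mxE.
  by case: (_ && _); rewrite ?normr1 ?normr0.
have -> : ball_proj y 0 i - t^-1 *: ((@phi_star R n \o shift y) (t *: d) - phi_star y) =
  t^-1 * (dot (ball_proj y) (t *: d) - (phi_star (t *: d + y) - phi_star y)).
  by rewrite dotZr dotC dot_delta -[t^-1 *: _]/(t^-1 * _) [RHS]mulrBr mulKf.
rewrite normrM normfV ler_pdivrMl ?normr_gt0//.
have := phi_star_subgradient y (t *: d + y).
have := phi_star_subgradient (t *: d + y) y.
rewrite addrK opprD addrCA subrr addr0 dotNr => H1 H2.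
apply: (@le_trans _ _ `|dot (ball_proj (t *: d + y) - ball_proj y) (t *: d)|).
  rewrite !(dotDl, dotNl) ler_norml; apply/andP; split.
    by rewrite lerNl (le_trans _ (ler_norm _))//; lra.
  by rewrite (le_trans _ (normr_ge0 _))//; lra.
rewrite (le_trans (dot_bound _ _))// normrZ.
have : `|ball_proj (t *: d + y) - ball_proj y| <= e / (n%:R + 1).
  apply: pr; rewrite addrK normrZ (le_lt_trans _ tr)//.
  by rewrite ler_piMr.
move=> H3.
apply: (@le_trans _ _ (n%:R * (e / (n%:R + 1)) * (`|t| * 1))).
  by rewrite ler_pM// ?ler_wpM2l// mulr_ge0.
rewrite mulr1 mulrC ler_wpM2l// mulrCA ler_piMr ?(ltW e0)//.
by rewrite ler_pdivrMr ?ltr_wpDl// mul1r lerDl.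
Unshelve. all: by end_near. Qed.

End BallProjection.

(** * Strict differentiability of the projection *)

Section BallProjectionDerivative.
Context {R : realType} {n : nat}.
Implicit Types (x y z : 'rV[R]_n).

Lemma strict_derivative_near (F G : 'rV[R]_n -> 'rV[R]_n) x A (r : R) : 0 < r ->
  (forall y, `|y - x| < r -> F y = G y) ->
  strict_derivative G x A -> strict_derivative F x A.
Proof.
move=> r0 FG GA e /GA[s s0 Gs]; exists (Num.min r s) => [|y z].
  by rewrite lt_min r0.
rewrite !lt_min => /andP[yr ys] /andP[zr zs].
by rewrite !FG//; exact: Gs.
Qed.

(** The difference of the inverse norms at y and z factors exactly as - <y - z, w(y, z)>
with w continuous at (x, x), so - w(x, x) is a strict gradient. *)
Lemma inv_enorm_strict x : 0 < enorm x ->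
  exists a : 'rV[R]_n, forall e : R, 0 < e -> exists2 r : R, 0 < r & forall y z,
    `|y - x| < r -> `|z - x| < r ->
    `|(enorm y)^-1 - (enorm z)^-1 - dot (y - z) a| <= e * `|y - z|.
Proof.
move=> x0.
pose w (p : 'rV[R]_n * 'rV[R]_n) : 'rV[R]_n :=
  (enorm p.1 * enorm p.2 * (enorm p.1 + enorm p.2))^-1 *: (p.1 + p.2).
have wc : {for (x, x), continuous w}.
  have c1 : {for (x, x), continuous (fun p : 'rV[R]_n * 'rV[R]_n => enorm p.1)}.
    by apply: (@continuous_comp _ _ _ fst (@enorm R n)); [exact: cvg_fst|exact: enorm_continuous].
  have c2 : {for (x, x), continuous (fun p : 'rV[R]_n * 'rV[R]_n => enorm p.2)}.
    by apply: (@continuous_comp _ _ _ snd (@enorm R n)); [exact: cvg_snd|exact: enorm_continuous].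
  apply: (@continuousZ R 'rV[R]_n _
    (fun p : 'rV[R]_n * 'rV[R]_n => (enorm p.1 * enorm p.2 * (enorm p.1 + enorm p.2))^-1)
    (fun p => p.1 + p.2) (x, x)).
    apply: continuousV; first by rewrite gt_eqF//= !mulr_gt0 ?addr_gt0.
    by apply: continuousM; [exact: continuousM|exact: continuousD].
  by apply: continuousD; [exact: cvg_fst|exact: cvg_snd].
exists (- w (x, x)) => e e0.
have en0 : 0 < e / (n%:R + 1) by rewrite divr_gt0// ltr_wpDl.
have [r r0 wr] := (continuous_at_epsdelta _ _).1 wc _ en0.
have x20 : 0 < enorm x / 2 by rewrite divr_gt0.
have [s s0 xs] := (continuous_at_epsdelta _ _).1 (@enorm_continuous R n x) _ x20.
have pos y : `|y - x| < s -> 0 < enorm y.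
  by move=> /xs; rewrite ler_norml => /andP[+ _]; lra.
exists (Num.min r s) => [|y z]; first by rewrite lt_min r0.
rewrite !lt_min => /andP[yr /pos y0] /andP[zr /pos z0].
have -> : (enorm y)^-1 - (enorm z)^-1 - dot (y - z) (- w (x, x)) =
    - dot (y - z) (w (y, z) - w (x, x)).
  suff -> : (enorm y)^-1 - (enorm z)^-1 = - dot (y - z) (w (y, z)).
    by rewrite !(dotDr, dotNr); ring.
  have -> : dot (y - z) (w (y, z)) =
    (enorm y * enorm z * (enorm y + enorm z))^-1 * (enorm y ^+ 2 - enorm z ^+ 2).
    by rewrite dotZr !enorm_sqr !dot_lin (dotC z y); congr (_ * _); ring.
  by field; rewrite !gt_eqF ?addr_gt0.
rewrite normrN (le_trans (dot_bound _ _))//.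
have : `|w (y, z) - w (x, x)| <= e / (n%:R + 1).
  by apply: wr; rewrite prod_normE /= gt_max yr zr.
move=> H; rewrite mulrAC (le_trans (ler_wpM2r (normr_ge0 _) (ler_wpM2l (ler0n _ _) H)))//.
rewrite ler_wpM2r// mulrCA ler_piMr ?(ltW e0)//.
by rewrite ler_pdivrMr ?ltr_wpDl// mul1r lerDl.
Qed.

Lemma strict_derivative_scale (s : 'rV[R]_n -> R) x (a : 'rV[R]_n) :
  (forall e : R, 0 < e -> exists2 r : R, 0 < r & forall y z,
    `|y - x| < r -> `|z - x| < r ->
    `|s y - s z - dot (y - z) a| <= e * `|y - z|) ->
  strict_derivative (fun y => s y *: y) x ((s x)%:M + a^T *m x).
Proof.
move=> sa e e0; have e30 : 0 < e / 3 by rewrite divr_gt0.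
have x10 : 0 < `|x| + 1 by rewrite ltr_wpDl.
have [r1 r10 s1] := sa 1 ltr01.
have [r2 r20 s2] := sa _ (divr_gt0 e30 x10).
(* Besides the two first-order terms, a cross term <y - z, a> (z - x) remains, which is
   small because z is close to x; 1 and e / 3 / K below serve it and s y - s x. *)
pose K := n%:R * `|a| + 1.
have K0 : 0 < K by rewrite ltr_wpDl// mulr_ge0.
pose r := Num.min (Num.min r1 r2) (Num.min 1 (e / 3 / K)).
have r0 : 0 < r by rewrite !lt_min r10 r20 ltr01 divr_gt0.
exists r => // y z; rewrite !lt_min.
move=> /andP[/andP[y1 y2] /andP[y3 y4]] /andP[/andP[z1 z2] /andP[z3 z4]].
have x1 : `|x - x| < r1 by rewrite subrr normr0.
have -> : s y *: y - s z *: z - (y - z) *m ((s x)%:M + a^T *m x) =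
    (s y - s x) *: (y - z) + (s y - s z - dot (y - z) a) *: z
    + dot (y - z) a *: (z - x).
  have -> : (y - z) *m ((s x)%:M + a^T *m x) = s x *: (y - z) + dot (y - z) a *: x.
    rewrite mulmxDr mul_mx_scalar mulmxA; congr (_ + _).
    by rewrite [X in X *m x]mx11_scalar -dotE mul_scalar_mx.
  by apply/rowP => i; rewrite !mxE; ring.
have dK t : `|dot t a| <= (K - 1) * `|t|.
  by rewrite (le_trans (dot_bound _ _))// /K addrK mulrAC.
have syx : `|s y - s x| <= e / 3.
  rewrite -(subrK (dot (y - x) a) (s y - s x)) (le_trans (ler_normD _ _))//.
  have := s1 _ _ y1 x1; have := dK (y - x).
  by move: y4; rewrite ltr_pdivlMr//; lra.
have zx : `|z| <= `|x| + 1.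
  by rewrite -(subrK x z) (le_trans (ler_normD _ _))// addrC lerD2l ltW.
rewrite (le_trans (ler_normD _ _))//.
have -> : e * `|y - z| = e / 3 * `|y - z| + e / 3 * `|y - z| + e / 3 * `|y - z| by field.
rewrite lerD//; first rewrite (le_trans (ler_normD _ _))// lerD//.
- by rewrite normrZ ler_wpM2r.
- rewrite normrZ.
  have := s2 _ _ y2 z2 => /(ler_pM (normr_ge0 _) (normr_ge0 z)) => /(_ _ zx).
  by move=> /le_trans; apply; rewrite mulrAC divfK// gt_eqF.
- rewrite normrZ mulrC.
  have -> : e / 3 * `|y - z| = (e / 3 / K) * (K * `|y - z|) by field; lra.
  rewrite ler_pM//; first exact: ltW.
  by rewrite (le_trans (dK _))// ler_wpM2r// gerBl.
Qed.

Lemma ball_proj_strict_small x : enorm x < 1 ->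
  strict_derivative (@ball_proj R n) x 1%:M.
Proof.
move=> x1; have d0 : 0 < 1 - enorm x by rewrite subr_gt0.
have [r r0 xr] := (continuous_at_epsdelta _ _).1 (@enorm_continuous R n x) _ d0.
apply: (strict_derivative_near r0 _ (@strict_derivative_id _ _ x)) => y /xr.
by rewrite ler_norml => /andP[_ H]; rewrite ball_proj_small//; lra.
Qed.

Lemma ball_proj_strict_large x : 1 < enorm x ->
  exists A, strict_derivative (@ball_proj R n) x A.
Proof.
move=> x1; have d0 : 0 < enorm x - 1 by rewrite subr_gt0.
have [r r0 xr] := (continuous_at_epsdelta _ _).1 (@enorm_continuous R n x) _ d0.
have [a xa] := inv_enorm_strict (lt_trans ltr01 x1).
exists ((enorm x)^-1%:M + a^T *m x).
apply: (strict_derivative_near r0 _ (strict_derivative_scale xa)) => y /xr.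
by rewrite ler_norml => /andP[H _]; rewrite ball_proj_large//; lra.
Qed.

Lemma ball_proj_strict x : enorm x != 1 ->
  exists A, strict_derivative (@ball_proj R n) x A.
Proof.
by case: ltgtP => // [/ball_proj_strict_small ?|/ball_proj_strict_large //] _; exists 1%:M.
Qed.

End BallProjectionDerivative.

(** * Null sets from local information *)

Section CountableCover.
Context {R : realType} {n : nat}.
Implicit Types (x y : 'rV[R]_n) (E : set 'rV[R]_n -> set 'rV[R]_n).

Definition sup_ball x (r : R) : set 'rV[R]_n := [set y | `|y - x| < r].

Definition rational_ball (c : 'rV[rat]_n * nat) : set 'rV[R]_n :=
  sup_ball (map_mx ratr c.1) c.2.+1%:R^-1.

Lemma rational_ball_basis x (r : R) : 0 < r -> exists c, exists2 s : R, 0 < s &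
  sup_ball x s `<=` rational_ball c /\ rational_ball c `<=` sup_ball x r.
Proof.
move=> r0; pose N := Num.truncn (2 / r).
have N0 : 0 < N.+1%:R^-1 :> R by rewrite invr_gt0 ltr0n.
have Nr : N.+1%:R^-1 * 2 < r.
  by rewrite mulrC ltr_pdivrMr ?ltr0n// mulrC -ltr_pdivrMr// truncnS_gt.
set d : R := N.+1%:R^-1 in N0 Nr.
have {}N0 : 0 < d / 2 by rewrite divr_gt0.
have q i : {q : rat | `|x 0 i - ratr q| < d / 2}.
  apply: cid; have [|q] := @rat_in_itvoo R (x 0 i - d / 2) (x 0 i + d / 2).
    by lra.
  by rewrite in_itv/= -ltr_distlC; exists q; rewrite // distrC.
have xq : `|x - map_mx ratr (\row_i sval (q i))| <= d / 2.
  apply: ler_mx_norm => [|k i]; first exact: ltW.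
  by rewrite ord1 !mxE ltW//; exact: (svalP (q i)).
exists (\row_i sval (q i), N), (d / 2) => //; rewrite /rational_ball/= -/d.
split=> y; rewrite /sup_ball/= => yq.
  by have := ler_distD x y (map_mx ratr (\row_i sval (q i))); lra.
have := ler_distD (map_mx ratr (\row_i sval (q i))) y x.
by rewrite (distrC (map_mx ratr (\row_i sval (q i))) x); lra.
Qed.

(** Countably many rational balls suffice to be inside a good ball of every point of S.
The set operator E allows two uses: for E Q the part of a fixed set that lies in Q, the
conclusion is that a locally null set is null; for E Q the set of points whose
orbit eventually stays in Q, it concerns the points attracted to S. *)
Lemma lebesgue_null_local (S : set 'rV[R]_n) E :
  (forall A B, A `<=` B -> E A `<=` E B) ->
  (forall x, S x -> exists2 r : R, 0 < r & lebesgue_null (E (sup_ball x r))) ->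
  lebesgue_null [set y | exists2 x, S x & forall r : R, 0 < r -> E (sup_ball x r) y].
Proof.
move=> Emono Sloc.
pose F c := if `[< lebesgue_null (E (rational_ball c)) >]
  then E (rational_ball c) else set0.
apply: (@lebesgue_null_sub _ _ _ (\bigcup_c F c)).
  move=> y [x Sx xE]; have [r r0 Er] := Sloc x Sx.
  have [c [s s0 [sc cr]]] := rational_ball_basis x r0.
  exists c => //; rewrite /F asboolT; last exact: lebesgue_null_sub (Emono _ _ cr) Er.
  exact: Emono sc _ (xE s s0).
apply: lebesgue_null_bigcup_countType => c; rewrite /F.
by case: asboolP => // _; exact: lebesgue_outer0.
Qed.

End CountableCover.

(** * Symmetry of the Hessian *)

Section Hessian.
Context {R : realType} {n : nat}.
Variable f : 'rV[R]_n -> R.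
Hypothesis df : forall x, differentiable f x.
Implicit Types (x y w : 'rV[R]_n).

Lemma derive_gradient x w : 'D_w f x = dot w (gradient f x).
Proof.
rewrite deriveE// [in LHS](row_sum_delta w) linear_sum; apply: eq_bigr => i _.
by rewrite linearZ mxE deriveE.
Qed.

(** The mean value theorem in direction i for v |-> f (v + s e_j) - f v turns the second
difference into s times an increment of the i-th partial derivative along s e_j. *)
Lemma second_difference x (H : 'M[R]_n) (i j : 'I_n) :
  strict_derivative (gradient f) x H ->
  forall e : R, 0 < e -> exists2 r : R, 0 < r & forall s : R, 0 < s -> s < r ->
  `|f (x + s *: delta_mx 0 i + s *: delta_mx 0 j) - f (x + s *: delta_mx 0 i)
    - f (x + s *: delta_mx 0 j) + f x - s ^+ 2 * H j i| <= e * s ^+ 2.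
Proof.
move=> GH e e0; have [r r0 Gr] := GH _ e0.
exists (r / 2) => [|s s0 sr]; first by rewrite divr_gt0.
set ei : 'rV[R]_n := delta_mx 0 i; set ej : 'rV[R]_n := delta_mx 0 j.
have d1 k : `|delta_mx 0 k : 'rV[R]_n| <= 1.
  apply: ler_mx_norm => // l m; rewrite mxE.
  by case: (_ && _); rewrite ?normr1 ?normr0.
have dfs u w : derivable (fun v => f (v + s *: ej) - f v) u w.
  apply: diff_derivable; apply: differentiableB => //.
  exact: (@differentiable_comp _ _ _ _ (fun v => v + s *: ej) f).
have [t /andP[t0 t1]] := MVT_line (fun t => dfs (x + t *: (s *: ei)) (s *: ei)).
set u := x + t *: (s *: ei).
have shiftD : 'D_(s *: ei) (fun v => f (v + s *: ej)) u = 'D_(s *: ei) f (u + s *: ej).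
  have E : (fun h : R => h^-1 *: (((fun v => f (v + s *: ej)) \o shift u)
        (h *: (s *: ei)) - f (u + s *: ej))) =
      (fun h : R => h^-1 *: ((f \o shift (u + s *: ej)) (h *: (s *: ei))
        - f (u + s *: ej))).
    apply/funext => h; congr (_ *: (f _ - _)).
    exact: (esym (addrA (h *: (s *: ei)) u (s *: ej))).
  by rewrite /derive E.
have ds w : derivable (fun v => f (v + s *: ej)) u w.
  apply: diff_derivable.
  exact: (@differentiable_comp _ _ _ _ (fun v => v + s *: ej) f).
rewrite deriveB//; last exact: diff_derivable.
rewrite shiftD !derive_gradient !dotZl !dot_delta => Dx.
have nd k : `|s *: delta_mx 0 k : 'rV[R]_n| <= s.
  by rewrite normrZ gtr0_norm// ler_piMr// ltW.
have ux : `|u - x| <= s.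
  rewrite /u addrAC subrr add0r normrZ ger0_norm//.
  by rewrite (le_trans _ (nd i))// ler_piMl.
clearbody u.
have uj : u + s *: ej - u = s *: ej by rewrite addrC addKr.
have u2x : `|u + s *: ej - x| < r.
  rewrite addrAC (le_lt_trans (ler_normD _ _))//.
  by have := nd j; rewrite -/ej; lra.
have u1x : `|u - x| < r by lra.
have H1 : `|gradient f (u + s *: ej) - gradient f u - s *: ej *m H| <= e * s.
  have := Gr _ _ u2x u1x; rewrite uj => /le_trans; apply.
  exact: ler_wpM2l (ltW e0) _ _ (nd j).
have := le_trans (ler_norm_entry _ 0 i) H1.
rewrite -scalemxAl -rowE !mxE => H2.
have -> : f (x + s *: ei + s *: ej) - f (x + s *: ei) - f (x + s *: ej) + f x
    - s ^+ 2 * H j i =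
    s * ('D_ei f (u + s *: ej) - 'D_ei f u - s * H j i).
  rewrite expr2 -mulrA [RHS]mulrBr; congr (_ - _).
  rewrite mulrBr; move: Dx; rewrite !mxE => <-.
  by rewrite opprB addrA addrAC.
by rewrite normrM gtr0_norm// expr2 mulrCA ler_wpM2l// ltW.
Qed.

(** Schwarz's theorem: the second difference is symmetric in i and j, while divided by s^2 it
tends to the (j, i) as well as to the (i, j) entry. *)
Lemma hessian_sym x : strict_derivative (gradient f) x (hessian f x) ->
  (hessian f x)^T = hessian f x.
Proof.
move=> GH; apply/matrixP => i j; rewrite mxE; set H := hessian f x in GH *.
apply/eqP; rewrite -subr_eq0 -normr_le0; apply/ler_addgt0Pr => e e0.
have e20 : 0 < e / 2 by rewrite divr_gt0.
have [r r0 ijr] := second_difference i j GH e20.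
have [t t0 jit] := second_difference j i GH e20.
pose s := Num.min r t / 2.
have m0 : 0 < Num.min r t by rewrite lt_min r0.
have s0 : 0 < s by rewrite divr_gt0.
have sm : s < Num.min r t by rewrite /s; lra.
move: (sm); rewrite lt_min => /andP[sr st].
have := ijr s s0 sr; have := jit s s0 st.
rewrite (addrAC x (s *: delta_mx 0 j)).
set a := f _; set b := f _; set c := f _; set d := f _ => H1 H2.
have s20 : 0 < s ^+ 2 by rewrite exprn_gt0.
rewrite add0r -(ler_pM2l s20) -[X in X * `|_|]gtr0_norm// -normrM.
move: H1 H2; rewrite !ler_norml => /andP[h1 h2] /andP[h3 h4].
apply/andP; split; lra.
Qed.

End Hessian.

(** * Maps with invertible derivatives *)

Section LocallyExpanding.
Context {R : realType} {n : nat}.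
Implicit Types (T : 'rV[R]_n -> 'rV[R]_n) (U Z : set 'rV[R]_n).

(** The injectivity half of the inverse function theorem. *)
Lemma strict_derivative_expanding T x A :
  strict_derivative T x A -> A \in unitmx ->
  exists r c : R, [/\ 0 < r, 0 < c & forall y z,
    sup_ball x r y -> sup_ball x r z -> c * `|y - z| <= `|T y - T z|].
Proof.
move=> TA Au; have [C C0 AC] := mulmx_bound (invmx A).
have c0 : 0 < (2 * C)^-1 by rewrite invr_gt0 mulr_gt0.
have [r r0 Tr] := TA _ c0; exists r, (2 * C)^-1; split => // y z yr zr.
have H1 := Tr y z yr zr.
have H2 : `|y - z| <= C * `|(y - z) *m A| by have := AC ((y - z) *m A); rewrite mulmxK.
have H3 : `|(y - z) *m A| <= `|T y - T z| + (2 * C)^-1 * `|y - z|.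
  have -> : (y - z) *m A = (T y - T z) - (T y - T z - (y - z) *m A).
    by rewrite opprB [RHS]addrC subrK.
  by rewrite (le_trans (ler_normB _ _))// lerD2l.
move: H1 H2 H3; move: `|(y - z) *m A| `|y - z| `|T y - T z| => a b d _ ba ad.
have {ba ad} : b <= C * (d + (2 * C)^-1 * b) by rewrite (le_trans ba)// ler_pM2l.
have -> : C * (d + (2 * C)^-1 * b) = C * d + b / 2 by field; lra.
move=> bd; rewrite mulrC ler_pdivrMr ?mulr_gt0//; lra.
Qed.

Lemma lebesgue_null_preimage T U Z : lebesgue_null (~` U) ->
  (forall x, U x -> exists2 A, strict_derivative T x A & A \in unitmx) ->
  lebesgue_null Z -> lebesgue_null (T @^-1` Z).
Proof.
move=> U0 TU Z0; pose E (Q : set 'rV[R]_n) := Q `&` T @^-1` Z.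
pose S := [set y | exists2 x, U x & forall r : R, 0 < r -> E (sup_ball x r) y].
apply: (@lebesgue_null_sub _ _ _ (~` U `|` (U `&` T @^-1` Z))).
  move=> y Ty; have [Uy|nUy] := pselect (U y); [by right|by left].
apply: lebesgue_nullU => //.
apply: (@lebesgue_null_sub _ _ _ S).
  move=> y [Uy Ty]; exists y => // r r0; split => //.
  by rewrite /sup_ball/= subrr normr0.
apply: lebesgue_null_local => [A B AB y [Ay Ty]|x Ux]; first by split => //; exact: AB.
have [A TA Au] := TU x Ux.
have [r [c [r0 c0 Tr]]] := strict_derivative_expanding TA Au.
by exists r => //; exact: (lebesgue_null_expanding c0 Tr).
Qed.

Lemma lebesgue_null_iter_preimage T Z m :
  (forall Z', lebesgue_null Z' -> lebesgue_null (T @^-1` Z')) ->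
  lebesgue_null Z -> lebesgue_null [set y | Z (iter m T y)].
Proof.
move=> T0 Z0; elim: m => [|m IH]//.
apply: (@lebesgue_null_sub _ _ _ (T @^-1` [set y | Z (iter m T y)])); last exact: T0.
by move=> y /=; rewrite -iterS iterSr.
Qed.

End LocallyExpanding.

(** * Sets whose differences avoid a cone *)

Section NegativeCone.
Context {R : realType} {n : nat}.

(** A union of boxes that are degenerate in direction j. *)
Lemma lebesgue_null_hyperplane (j : 'I_n) :
  lebesgue_null [set z : 'rV[R]_n | z 0 j = 0].
Proof.
pose a (N : nat) : 'rV[R]_n := \row_i (if i == j then 0 else - N%:R).
pose b (N : nat) : 'rV[R]_n := \row_i (if i == j then 0 else N%:R).
apply: (@lebesgue_null_sub _ _ _ (\bigcup_N box (a N) (b N))).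
  move=> z /= zj; exists (Num.truncn `|z|).+1 => // i; rewrite !mxE.
  case: eqP => [->|_]; first by rewrite zj lexx.
  rewrite -ler_norml (le_trans (ler_norm_entry z 0 i))// ltW//.
  exact: truncnS_gt.
apply: lebesgue_null_bigcup => N.
apply/eqP; rewrite eq_le lebesgue_outer_ge0 andbT.
rewrite (le_trans (lebesgue_outer_box _ _))// lee_fin /box_volume.
by rewrite (bigD1 j)//= !mxE eqxx subrr maxxx mul0r.
Qed.

Definition quad (N : 'M[R]_n) (w : 'rV[R]_n) : R := dot w (w *m N).

Lemma quad_bound (N : 'M[R]_n) : exists2 K, 0 < K &
  forall u w : 'rV[R]_n, `|dot u (w *m N)| <= K * `|u| * `|w|.
Proof.
have [C C0 NC] := mulmx_bound N; exists (n%:R * C + 1).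
  by rewrite ltr_wpDl// mulr_ge0// ltW.
move=> u w; rewrite (le_trans (dot_bound _ _))//.
rewrite (le_trans (ler_wpM2l _ (NC w)))// ?mulr_ge0//.
have := normr_ge0 u; have := normr_ge0 w; nra.
Qed.

(** Project along v to the hyperplane where the j-th coordinate vanishes, for some j with
v_j <> 0. A difference d = s v + u, with u in the hyperplane, has quad N d > 0 as
soon as |s| is large compared to |u|; so here |s|, hence |d|, is at most a multiple of
|u|, and the projection is expanding on W up to a constant. *)
Lemma lebesgue_null_cone (N : 'M[R]_n) (v : 'rV[R]_n) (W : set 'rV[R]_n) :
  0 < quad N v -> (forall x y, W x -> W y -> quad N (x - y) <= 0) ->
  lebesgue_null W.
Proof.
move=> pv Wp; have [K K0 NK] := quad_bound N.
have [j vj] : exists j, v 0 j != 0.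
  apply/existsP; rewrite -negb_forall; apply/negP => /forallP v0.
  have v00 : v = 0 by apply/rowP => j; rewrite mxE; apply/eqP/v0.
  by move: pv; rewrite v00 /quad dotE !mul0mx mxE ltxx.
pose G (x : 'rV[R]_n) := x - (x 0 j / v 0 j) *: v.
(* For |s| > M |u| the term s^2 quad N v beats the mixed terms and quad N u; M >= 1
   also ensures |u| <= |s|. *)
pose M := 1 + K * (2 * `|v| + 1) / quad N v.
have M1 : 1 <= M by rewrite lerDl divr_ge0 ?(ltW pv)// mulr_ge0 ?addr_ge0 ?mulr_ge0// ltW.
have Mv0 : 0 < M * `|v| + 1 by rewrite ltr_wpDl// mulr_ge0// (le_trans ler01).
apply: (@lebesgue_null_sub _ _ _ (W `&` G @^-1` [set z | z 0 j = 0])).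
  by move=> x Wx; split => //; rewrite /G/= !mxE divfK// subrr.
apply: (@lebesgue_null_expanding _ _ G _ _ (M * `|v| + 1)^-1); last 2 first.
- move=> x y Wx Wy; have {}Wp := Wp x y Wx Wy.
  have -> : G x - G y = G (x - y) by rewrite /G; apply/rowP => i; rewrite !mxE; ring.
  move: (x - y) Wp => d dp; rewrite mulrC ler_pdivrMr//.
  set u := G d; set s := d 0 j / v 0 j.
  have dE : d = s *: v + u by rewrite /u /G addrC subrK.
  suff sM : `|s| <= M * `|u|.
    rewrite [in leLHS]dE (le_trans (ler_normD _ _))// normrZ.
    rewrite mulrDr mulr1 lerD2r mulrA ler_wpM2r// mulrC//.
  clearbody u s; rewrite leNgt; apply/negP => Ms.
  move: dp; rewrite leNgt => /negP; apply.
  have -> : quad N d = s ^+ 2 * quad N v + (s * (dot v (u *m N) + dot u (v *m N))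
      + dot u (u *m N)).
    by rewrite dE /quad mulmxDl -scalemxAl !dot_lin; ring.
  have s0 : 0 < `|s| by rewrite (le_lt_trans _ Ms)// mulr_ge0// (le_trans ler01).
  have us : `|u| <= `|s|.
    by rewrite (le_trans _ (ltW Ms))// ler_peMl.
  have H1 := NK v u; have H2 := NK u v; have H3 := NK u u.
  have : K * `|u| * (2 * `|v| + 1) < quad N v * `|s|.
    apply: (@le_lt_trans _ _ (quad N v * (M * `|u|))); last by rewrite ltr_pM2l.
    have -> : quad N v * (M * `|u|) =
      quad N v * `|u| + K * `|u| * (2 * `|v| + 1) by rewrite /M; field; lra.
    by rewrite lerDr mulr_ge0// ltW.
  move=> H4.
  have H5 : K * `|u| * (2 * `|v| + 1) * `|s| < quad N v * s ^+ 2.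
    by rewrite -real_normK ?num_real// expr2 mulrA ltr_pM2r.
  have H6 : `|s * (dot v (u *m N) + dot u (v *m N))| <= `|s| * (2 * (K * `|u| * `|v|)).
    rewrite normrM ler_wpM2l// (le_trans (ler_normD _ _))//.
    by move: H1; rewrite (mulrAC K); lra.
  have H7 : `|dot u (u *m N)| <= K * `|u| * `|s|.
    by rewrite (le_trans H3)// ler_wpM2l// mulr_ge0// ltW.
  move: H6 H7; rewrite !ler_norml => /andP[H6 _] /andP[H7 _].
  move: H5 H6 H7; move: (dot u _) (s * _) (s ^+ 2) => a b e.
  move: `|s| `|u| `|v| (quad N v) => p q r t.
  lra.
- exact: lebesgue_null_hyperplane.
- by rewrite invr_gt0.
Qed.

End NegativeCone.

(** * Orbits trapped near a fixed point with an unstable direction *)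

Section SpectralGap.
Context {R : realType} {n : nat}.

Lemma unitmx_not_eigenvalue (B : 'M[R]_n) (a : R) :
  ~~ eigenvalue B a -> B - a%:M \in unitmx.
Proof. by rewrite negbK kermx_eq0 row_free_unit. Qed.

(** A matrix of size n has at most n eigenvalues, and n + 1 candidates lie in the interval. *)
Lemma spectral_gap (B : 'M[R]_n) (a b : R) : a < b ->
  exists2 c, a < c < b & B - c%:M \in unitmx.
Proof.
move=> ab; pose g (k : nat) : R := a + (b - a) / k.+2%:R.
have gab k : a < g k < b.
  rewrite /g ltrDl divr_gt0 ?subr_gt0 ?ltr0n//= -ltrBrDl ltr_pdivrMr ?ltr0n//.
  by rewrite ltr_pMr ?subr_gt0// ltr1n.
have [/allP gB|/allPn[_ /mapP[k _ ->] /unitmx_not_eigenvalue gk]] :=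
    boolP (all (eigenvalue B) [seq g k | k <- iota 0 n.+1]); last by exists (g k).
have := @max_poly_roots _ (char_poly B) [seq g k | k <- iota 0 n.+1].
rewrite size_char_poly size_map size_iota ltnn => H; exfalso; suff: false by [].
apply: H.
- by rewrite -size_poly_eq0 size_char_poly.
- by apply/allP => x /gB; rewrite eigenvalue_root_char.
- rewrite map_inj_uniq ?iota_uniq// => k l /addrI /mulfI kl.
  apply/eqP; rewrite -eqSS -[_ == _]eqSS -(eqr_nat R); apply/eqP/invr_inj/kl.
  by rewrite subr_eq0 gt_eqF.
Qed.

End SpectralGap.

Lemma expr_unbounded (R : realType) (nu M : R) : 1 < nu -> exists k, M < nu ^+ k.
Proof.
move=> nu1; have d0 : 0 < nu - 1 by rewrite subr_gt0.
have bern k : 1 + k%:R * (nu - 1) <= nu ^+ k.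
  elim: k => [|k IH]; first by rewrite mul0r addr0 expr0.
  have : 0 <= k%:R * (nu - 1) ^+ 2 by rewrite mulr_ge0// sqr_ge0.
  have : 0 <= nu * (nu ^+ k - (1 + k%:R * (nu - 1))).
    by rewrite mulr_ge0 ?subr_ge0// ltW// (lt_trans ltr01).
  rewrite (exprS nu) -natr1; move: (k%:R : R) (nu ^+ k) => p q H1 H2.
  rewrite -subr_ge0.
  have -> : nu * q - (1 + (p + 1) * (nu - 1)) =
    p * (nu - 1) ^+ 2 + nu * (q - (1 + p * (nu - 1))) by ring.
  exact: addr_ge0.
exists (Num.truncn (`|M| / (nu - 1))).+1; apply: lt_le_trans (bern _).
have : `|M| < (Num.truncn (`|M| / (nu - 1))).+1%:R * (nu - 1).
  by rewrite -ltr_pdivrMr// truncnS_gt.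
by have := ler_norm M; lra.
Qed.

Section Trap.
Context {R : realType} {n : nat}.
Implicit Types (T : 'rV[R]_n -> 'rV[R]_n) (x y : 'rV[R]_n).

Definition trap T x (r : R) : set 'rV[R]_n :=
  [set y | forall k, sup_ball x r (iter k T y)].

(** A and N commute, and A A = N + nu. *)
Lemma quad_mulmx (A : 'M[R]_n) (nu : R) w : A^T = A ->
  let N := A *m A - nu%:M in
  quad N (w *m A) = nu * quad N w + dot (w *m N) (w *m N).
Proof.
move=> As N; have Ns : N^T = N.
  by rewrite /N linearB/= trmx_mul As tr_scalar_mx.
have NA : N *m A = A *m N.
  by rewrite /N mulmxBl mulmxBr mulmxA scalar_mxC.
have AA : A *m A = N + nu%:M by rewrite /N subrK.
rewrite /quad dot_mulmx As -!mulmxA NA !mulmxA.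
rewrite -(mulmxA w A A) AA mulmxDr mulmxDl mul_mx_scalar -scalemxAl !dot_lin.
by rewrite addrC dot_mulmx Ns.
Qed.

(** The extra term |d N|^2 in the expansion of the form along A is at least a multiple of
|d|^2, as N is invertible; this outweighs an error of relative size e in d A. *)
Lemma quad_perturbation (A : 'M[R]_n) (nu : R) : A^T = A ->
  let N := A *m A - nu%:M in N \in unitmx ->
  exists2 e : R, 0 < e & forall d d' : 'rV[R]_n,
    `|d' - d *m A| <= e * `|d| -> nu * quad N d <= quad N d'.
Proof.
move=> As N Nu; have [K K0 NK] := quad_bound N.
have [a a0 Aa] := mulmx_bound A.
have [C C0 NC] := mulmx_bound (invmx N).
(* With |u| <= e |d| and e <= 1, the three terms that involve u are at most
   e L |d|^2, and |d N|^2 is at least |d|^2 / C^2. *)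
pose L := K * (2 * a + 1).
have L0 : 0 < L by rewrite mulr_gt0// addr_gt0// mulr_gt0.
have Ci0 : 0 < (C ^+ 2)^-1 by rewrite invr_gt0 exprn_gt0.
exists (Num.min 1 ((C ^+ 2)^-1 / L)) => [|d d'].
  by rewrite lt_min ltr01 divr_gt0.
set e := Num.min _ _; have e0 : 0 < e by rewrite lt_min ltr01 divr_gt0.
have e1 : e <= 1 by rewrite ge_min lexx.
have eL : e * L <= (C ^+ 2)^-1 by rewrite -ler_pdivlMr// ge_min lexx orbT.
set w := d *m A; rewrite -[in quad N d'](subrK w d').
move: (d' - w) => u ud.
have -> : quad N (u + w) = quad N w + (dot u (u *m N) + dot u (w *m N) + dot w (u *m N)).
  by rewrite /quad mulmxDl !dot_lin; ring.
have H0 : (C ^+ 2)^-1 * `|d| ^+ 2 <= dot (d *m N) (d *m N).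
  apply: le_trans (sqr_norm_le_dot _).
  rewrite mulrC ler_pdivrMr ?exprn_gt0// mulrC -exprMn lerXn2r ?nnegrE ?mulr_ge0 ?(ltW C0)//.
  by have := NC (d *m N); rewrite mulmxK.
have H1 := NK u u; have H2 := NK u w; have H3 := NK w u.
have wa : `|w| <= a * `|d| by exact: Aa.
rewrite quad_mulmx//.
have H : `|dot u (u *m N) + dot u (w *m N) + dot w (u *m N)| <= e * L * `|d| ^+ 2.
  rewrite !(le_trans (ler_normD _ _))//.
  have -> : e * L * `|d| ^+ 2 = K * (e * `|d|) * `|d| +
     K * (e * `|d|) * (a * `|d|) + K * (a * `|d|) * (e * `|d|) by rewrite /L; ring.
  have Ke : K * `|u| <= K * (e * `|d|) by rewrite ler_pM2l.
  have Kw : K * `|w| <= K * (a * `|d|) by rewrite ler_pM2l.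
  have ud1 : `|u| <= `|d| by rewrite (le_trans ud)// ler_piMl.
  rewrite lerD//; first rewrite (le_trans (ler_normD _ _))// lerD//.
  - by rewrite (le_trans H1)// ler_pM// mulr_ge0// ltW.
  - by rewrite (le_trans H2)// ler_pM// mulr_ge0// ltW.
  - by rewrite (le_trans H3)// ler_pM// mulr_ge0// ltW.
have {}eL : e * L * `|d| ^+ 2 <= (C ^+ 2)^-1 * `|d| ^+ 2 by rewrite ler_wpM2r// sqr_ge0.
move: H; rewrite ler_norml => /andP[H _]; move: H H0 eL.
rewrite -/N.
move: (quad N d) (dot (d *m N) _) (_ + _) (_ * _ * _) (_^-1 * _) => p q s t z.
lra.
Qed.

(** The form quad N grows geometrically along the difference of two trapped orbits if it is
positive initially, which the boundedness of the ball forbids; so differences of trapped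
points avoid the cone quad N > 0, which contains v. *)
Lemma lebesgue_null_trap T x (A : 'M[R]_n) (alpha : R) (v : 'rV[R]_n) :
  strict_derivative T x A -> A^T = A ->
  1 < alpha -> v != 0 -> v *m A = alpha *: v ->
  exists2 r : R, 0 < r & lebesgue_null (trap T x r).
Proof.
move=> TA As al1 v0 vA.
have al2 : 1 < alpha ^+ 2 by rewrite exprn_egt1.
have [nu /andP[nu1 nual] Nu] := spectral_gap (A *m A) al2.
have [e e0 Ne] := quad_perturbation As Nu.
set N := A *m A - nu%:M in Nu Ne.
have [r r0 Tr] := TA e e0; exists r => //.
apply: (@lebesgue_null_cone _ _ N v).
  have -> : quad N v = (alpha ^+ 2 - nu) * dot v v.
    rewrite /quad /N mulmxBr mulmxA vA -scalemxAl vA mul_mx_scalar scalerA -scalerBl.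
    by rewrite dotZr.
  rewrite mulr_gt0 ?subr_gt0// (lt_le_trans _ (sqr_norm_le_dot v))//.
  by rewrite exprn_gt0// normr_gt0.
move=> y z yr zr; rewrite leNgt; apply/negP => yz0.
have grow k : nu ^+ k * quad N (y - z) <= quad N (iter k T y - iter k T z).
  elim: k => [|k IH]; first by rewrite expr0 mul1r.
  rewrite exprS -mulrA; apply: (@le_trans _ _ (nu * quad N (iter k T y - iter k T z))).
    by rewrite ler_wpM2l// ltW// (lt_trans ltr01).
  apply: Ne; rewrite !iterS; apply: Tr; [exact: yr|exact: zr].
have [K K0 NK] := quad_bound N.
have [k] := expr_unbounded (K * (r * 2) * (r * 2) / quad N (y - z)) nu1.
rewrite ltr_pdivrMr// => /lt_le_trans /(_ (grow k)); apply/negP; rewrite -leNgt.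
apply: le_trans (ler_norm _) _; apply: le_trans (NK _ _) _.
have H : `|iter k T y - iter k T z| <= r * 2.
  have := ler_distD x (iter k T y) (iter k T z).
  have := yr k; have := zr k; rewrite /sup_ball/= [`|x - _|]distrC; lra.
by rewrite ler_pM// ?ler_wpM2l// ?mulr_ge0// ltW.
Qed.

End Trap.

(** * The preconditioned gradient method *)

Section Eigenvalues.
Context {R : realType} {n : nat}.
Implicit Types (B H P : 'M[R]_n).

Lemma eigenvalue_le_lambda_max B (a : R) : eigenvalue B a -> a <= lambda_max B.
Proof.
move=> Ba; apply: ub_le_sup => //; have [C C0 BC] := mulmx_bound B.
exists C => b /eigenvalueP[v vB v0]; have := BC v.
rewrite vB normrZ ler_pM2r ?normr_gt0//; exact: le_trans (ler_norm _).
Qed.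

Lemma lambda_min_lt0 B : lambda_min B < 0 -> exists2 a, a < 0 & eigenvalue B a.
Proof.
move=> B0; have [//|nB] := pselect (exists2 a, a < 0 & eigenvalue B a).
exfalso; move: B0; apply/negP; rewrite -leNgt /lambda_min.
have [->|/set0P[a Ba]] := eqVneq [set a | eigenvalue B a] set0.
  by rewrite inf0.
apply: lb_le_inf; first by exists a.
by move=> b Bb; rewrite leNgt; apply/negP => b0; apply: nB; exists b.
Qed.

(** P H and H P have the same nonzero eigenvalues: if w is fixed by c H P, then w H is an
eigenvector of P H for 1 / c. *)
Lemma step_derivative_unit H P (c : R) : 0 < c -> lambda_max (P *m H) < c^-1 ->
  1%:M - c *: (H *m P) \in unitmx.
Proof.
move=> c0 PHc; rewrite -opprB -scaleN1r unitmxZ ?unitrN1//.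
apply: unitmx_not_eigenvalue; apply/negP => /eigenvalueP[w].
rewrite scale1r -scalemxAr mulmxA => wE w0.
have : c^-1 <= lambda_max (P *m H); last by rewrite leNgt PHc.
apply: eigenvalue_le_lambda_max; apply/eigenvalueP; exists (w *m H).
  rewrite mulmxA -[in RHS]wE -scalemxAl scalerA mulVf ?scale1r//.
  by rewrite gt_eqF.
by apply: contraNneq w0 => wH; rewrite -wE wH mul0mx scaler0.
Qed.

End Eigenvalues.

Section PreconditionedGradient.
Context {R : realType} {n : nat}.
Variables (f : 'rV[R]_n -> R) (gamma Lbar : R).
Hypotheses (hf : C2plus f) (hLbar : 0 < Lbar) (hgamma : 0 < gamma).
Implicit Types (x y : 'rV[R]_n).

Let T := pgm_step f gamma Lbar.

Lemma pgm_stepE x : T x = x - gamma *: ball_proj (Lbar^-1 *: gradient f x).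
Proof. by rewrite /T /pgm_step gradient_phi_star. Qed.

Lemma ball_proj_scale (g : 'rV[R]_n) :
  ball_proj (Lbar^-1 *: g) = Num.min (enorm g)^-1 Lbar^-1 *: g.
Proof.
have Li0 : 0 < Lbar^-1 by rewrite invr_gt0.
rewrite /ball_proj enormZ ?(ltW Li0)// scalerA.
have [g0|g0] := eqVneq (enorm g) 0.
  have -> : g = 0 by apply/eqP; rewrite -normr_le0 -g0 norm_le_enorm.
  by rewrite !scaler0.
have {}g0 : 0 < enorm g by rewrite lt_neqAle eq_sym g0 enorm_ge0.
congr (_ *: _); have [gL|Lg] := leP (enorm g) Lbar.
  rewrite max_l; last by rewrite mulrC ler_pdivrMr// mul1r.
  by rewrite invr1 mul1r min_r// lef_pV2.
rewrite max_r; last by rewrite mulrC ler_pdivlMr// mul1r ltW.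
rewrite min_l; last by rewrite lef_pV2// ltW.
by rewrite invfM invrK mulrAC mulfV ?mul1r// gt_eqF.
Qed.

Lemma gradient_strict x : strict_derivative (gradient f) x (hessian f x).
Proof. by case: hf => _ dG cH _; apply: C1_strict_derivative => //; exact: cH. Qed.

Lemma pgm_step_strict x P :
  strict_derivative (@ball_proj R n) (Lbar^-1 *: gradient f x) P ->
  strict_derivative T x (1%:M - (gamma / Lbar) *: (hessian f x *m P)).
Proof.
move=> hP.
rewrite (_ : T = fun x => x - gamma *: ball_proj (Lbar^-1 *: gradient f x)); last first.
  by apply/funext => y; exact: pgm_stepE.
rewrite -scalerA [Lbar^-1 *: _]scalemxAl.
apply: strict_derivativeB; first exact: strict_derivative_id.
apply: strict_derivativeZ.
apply: (strict_derivative_comp (F := fun y => Lbar^-1 *: gradient f y)) => //.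
exact/strict_derivativeZ/gradient_strict.
Qed.

(** On U the argument of the projection is off the unit sphere, and the Hessian of phi^* is the
derivative of the projection there. The condition gamma < 1 / L makes L Lbar smaller than
Lbar / gamma. *)
Lemma pgm_step_derivative_unit (L : R) x : enorm (gradient f x) <> Lbar ->
  lambda_max (hessian (@phi_star R n) (Lbar^-1 *: gradient f x) *m hessian f x)
    <= L * Lbar ->
  0 < L -> gamma < L^-1 ->
  exists2 A, strict_derivative T x A & A \in unitmx.
Proof.
move=> xU hx L0 gL; have Li0 : 0 <= Lbar^-1 by rewrite invr_ge0 ltW.
have [|P hP] := @ball_proj_strict _ _ (Lbar^-1 *: gradient f x).
  apply/eqP; rewrite enormZ// => /(congr1 (fun t => Lbar * t)).
  by rewrite mulr1 mulrA mulfV ?mul1r// gt_eqF.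
exists (1%:M - (gamma / Lbar) *: (hessian f x *m P)); first exact: pgm_step_strict.
have PE : hessian (@phi_star R n) (Lbar^-1 *: gradient f x) = P.
  rewrite /hessian (_ : gradient _ = @ball_proj R n); last first.
    by apply/funext => y; exact: gradient_phi_star.
  exact: strict_derivative_jacobian.
apply: step_derivative_unit; first exact: divr_gt0.
rewrite PE in hx; apply: (le_lt_trans hx).
rewrite invfM invrK ltr_pM2r// -[L]invrK ltf_pV2// posrE invr_gt0//.
Qed.

(** At a critical point the projection acts as the identity, so the derivative of T is
1 - (gamma / Lbar) H, in which a negative eigenvalue of H becomes one above 1. *)
Lemma trap_strict_saddle x : strict_saddle f x ->
  exists2 r : R, 0 < r & lebesgue_null (trap T x r).
Proof.
move=> [gx0 /lambda_min_lt0[a a0 /eigenvalueP[v vH v0]]].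
have TA := @pgm_step_strict x 1%:M.
apply: (@lebesgue_null_trap _ _ T x _ (1 - gamma / Lbar * a) v (TA _)) => //.
- by apply: ball_proj_strict_small; rewrite gx0 scaler0 /enorm dotE mul0mx mxE sqrtr0.
- rewrite mulmx1 linearB/= linearZ/= tr_scalar_mx hessian_sym//.
    by case: hf.
  exact: gradient_strict.
- by rewrite ltrDl oppr_gt0 pmulr_rlt0// divr_gt0.
- by rewrite mulmx1 mulmxBr mulmx1 -scalemxAr vH scalerA scalerBl scale1r.
Qed.

Lemma lebesgue_null_strict_saddle_basin :
  (forall Z, lebesgue_null Z -> lebesgue_null (T @^-1` Z)) ->
  lebesgue_null [set x0 | exists2 xstar, strict_saddle f xstar &
    pgm f gamma Lbar x0 @ \oo --> xstar].
Proof.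
move=> T0.
pose E (Q : set 'rV[R]_n) := \bigcup_m [set y | forall k, Q (iter k T (iter m T y))].
pose S := [set y | exists2 x, strict_saddle f x & forall r : R, 0 < r -> E (sup_ball x r) y].
apply: (@lebesgue_null_sub _ _ _ S).
  move=> y [x sx yx]; exists x => // r r0.
  have /cvgrPdist_lt/(_ r r0)[m _ mr] := yx.
  exists m => // k; rewrite -iterD /sup_ball/= distrC.
  by apply: mr; rewrite /= leq_addl.
apply: lebesgue_null_local => [A B AB y [m _ Ay]|x /trap_strict_saddle[r r0 tr]].
  by exists m => // k; exact: AB.
exists r => //; apply: lebesgue_null_bigcup => m.
exact: (lebesgue_null_iter_preimage m T0 tr).
Qed.

End PreconditionedGradient.

Theorem theorem3p2 (R : realType) (n : nat) (f : 'rV[R]_n -> R)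
    (L Lbar gamma : R) (U : set 'rV[R]_n)
    (hf : C2plus f)
    (hL : 0 < L) (hLbar : 0 < Lbar)
    (hU : U = [set x | enorm (gradient f x) <> Lbar])
    (hUfull : lebesgue_null (~` U))
    (hsmooth : forall x, U x ->
      lambda_max (hessian (@phi_star R n) (Lbar^-1 *: gradient f x) *m hessian f x)
        <= L * Lbar)
    (hgamma : 0 < gamma < L^-1) :
  (forall (x0 : 'rV[R]_n) (k : nat),
     pgm f gamma Lbar x0 k.+1 =
       pgm f gamma Lbar x0 k -
       (gamma * Num.min (enorm (gradient f (pgm f gamma Lbar x0 k)))^-1 Lbar^-1)
         *: gradient f (pgm f gamma Lbar x0 k)) /\
  lebesgue_null
    [set x0 : 'rV[R]_n | exists2 xstar, strict_saddle f xstar &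
       pgm f gamma Lbar x0 @ \oo --> xstar].
Proof.
have /andP[g0 gL] := hgamma; split=> [x0 k|].
  by rewrite /pgm iterS pgm_stepE ball_proj_scale// scalerA.
apply: lebesgue_null_strict_saddle_basin => // Z Z0.
apply: (lebesgue_null_preimage hUfull) Z0 => x Ux.
apply: (@pgm_step_derivative_unit _ _ f gamma Lbar hf hLbar g0 L) => //.
  by move: Ux; rewrite hU.
exact: hsmooth.
Qed.
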